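(* Let $q=p^k$ for some odd prime $p$ and $k\geq 1$, and let $f\in \mathbb{F}_q[x]$ with $d:=\deg(f)\geq 2$. Suppose that $f$ is \textbf{not} of any of the following forms: (a) $f=A(x-B)^{p^e}$ for some $A,B\in \mathbb{F}_q$, $e\geq 1$; (b) $f=Ag^2$ for some $A\in\mathbb{F}_q$, $g\in\mathbb{F}_q[x]$; (c) $f=Axg^2$ for some $A\in\mathbb{F}_q$, $g\in\mathbb{F}_q[x]$; (d) $f=Ah^2+B$, where $A,B\in\mathbb{F}_q$ and $h=\sum_{i=0}^{n}a_ix^i$ satisfies $a_0=\pm\sqrt{-\frac{B}{A}}$ and $i(2i-1)Ba_i=-2(n+i-1)(n-i+1)a_{i-1}$ for $i\in\{1,2,\dots,n\}$; (e) $f=A(x-B)g^2$, where $A,B\in\mathbb{F}_q$ and $g=\sum_{i=0}^{n}a_ix^i$ satisfies $\pm a_0=\sqrt{-\frac{1}{A}}$ and $i(2i-1)Ba_i=-2(n-i+1)(n+i)a_{i-1}$ for $i=1,2,\dots,n$. Let $a\in\mathbb{F}_q$. Suppose that the sequence $(\chi(f^n(a)))_{n\geq 0}$ is periodic, and let $m$ be its period. Then \[|\mathcal{O}_f(a)|=O\left(m\,q^{\frac{2\log_2(d)+1}{2\log_2(d)+2}}\right),\] where the implied constant depends only on $d$.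
   Context: $f^n$ denotes the $n$-th iterate of $f$ under composition, with $f^0=x$. $\chi$ is the quadratic character of $\mathbb{F}_q$ (with $\chi(0)=0$). $\mathcal{O}_f(a)=\{a,f(a),f^2(a),\dots\}$ is the forward orbit of $a$. In (d) and (e), $n$ is a nonnegative integer and the square root denotes a square root in an algebraic closure of $\mathbb{F}_q$. *)

(* Defs.v *)
From HB Require Import structures.
From mathcomp Require Import all_boot all_order all_algebra.
From mathcomp Require Import all_classical all_reals exp.

Set Implicit Arguments.
Unset Strict Implicit.
Unset Printing Implicit Defensive.

Import Order.TTheory GRing.Theory Num.Theory.
Local Open Scope ring_scope.

Definition poly_iter (F : finFieldType) (f : {poly F}) (n : nat) : {poly F} :=
  iter n (fun g => f \Po g) 'X.

Definition forward_orbit (F : finFieldType) (f : {poly F}) (a : F) : {set F} :=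
  [set b : F | `[< exists n : nat, b = (poly_iter f n).[a] >]].

Definition quad_char (F : finFieldType) (x : F) : int :=
  if x == 0 then 0 else if [exists y : F, y ^+ 2 == x] then 1 else -1.

(* Pure (not merely eventual) periodicity. *)
Definition is_period_of (T : Type) (u : nat -> T) (m : nat) : Prop :=
  (0 < m)%N /\ forall n : nat, u (n + m)%N = u n.

Definition is_least_period_of (T : Type) (u : nat -> T) (m : nat) : Prop :=
  is_period_of u m /\ forall l : nat, is_period_of u l -> (m <= l)%N.

Definition log2 (R : realType) (x : R) : R := ln x / ln 2.

Section Forms.
Context (F : finFieldType) (f : {poly F}).

Definition form_a (p : nat) : Prop :=
  exists (A B : F) (e : nat),
    (1 <= e)%N /\ f = A%:P * ('X - B%:P) ^+ (p ^ e)%N.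

Definition form_b : Prop :=
  exists (A : F) (g : {poly F}), f = A%:P * g ^+ 2.

Definition form_c : Prop :=
  exists (A : F) (g : {poly F}), f = A%:P * 'X * g ^+ 2.

(* In the last two forms, [iota : F -> K] is meant to be an algebraic closure.
   The square root giving the constant coefficient need not lie in [F], so the
   coefficients [s i] are taken in [K] and the identity for [f] is read in
   [{poly K}].  The clause [s 0 ^+ 2 = c] says that [s 0] is one of the two
   square roots of [c]. *)
Context (K : closedFieldType) (iota : {rmorphism F -> K}).

Definition form_d : Prop :=
  exists (A B : F) (n : nat) (s : nat -> K),
    [/\ map_poly iota f
          = (iota A)%:P * (\poly_(i < n.+1) s i) ^+ 2 + (iota B)%:P,
        s 0%N ^+ 2 = - (iota B / iota A)
      & forall i : nat, (1 <= i <= n)%N ->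
          i%:R * (2 * i%:R - 1) * iota B * s i
          = - 2 * (n%:R + i%:R - 1) * (n%:R - i%:R + 1) * s i.-1].

Definition form_e : Prop :=
  exists (A B : F) (n : nat) (s : nat -> K),
    [/\ map_poly iota f
          = (iota A)%:P * ('X - (iota B)%:P) * (\poly_(i < n.+1) s i) ^+ 2,
        s 0%N ^+ 2 = - (1 / iota A)
      & forall i : nat, (1 <= i <= n)%N ->
          i%:R * (2 * i%:R - 1) * iota B * s i
          = - 2 * (n%:R - i%:R + 1) * (n%:R + i%:R) * s i.-1].

End Forms.

(* Main.v *)
(* Fix a residue class of times modulo m: all its orbit points b show the same
   signs chi (f^i b), i < r.  Expanding prod_(i < r) (1 + u_i chi (f^i b)), the
   number of such b is at most q / 2^r plus the largest of the character sums
   sum_b chi (prod_(i in S) f^i b), S nonempty, and Weil's bound makes these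
   O(d^r sqrt q) as soon as no product prod_(i in S) f^i is a constant times a
   square.  Taking (2 d)^r close to sqrt q balances the two terms.

   The bound for the character sums is obtained by Stepanov's method.

   The products are not squares because, for every n, some x reaches 0 under f
   for the first time at step n, through points of odd ramification index.  If
   that fails at some step, Riemann-Hurwitz leaves room for very few ramified
   fibers, and f has one of the shapes c g^2, c x g^2, c (x - b)^(p^e),
   c h^2 + y = c x (x - y) k^2, or c (x - y) g^2 = c x k^2 + y.  Differentiating
   the last two double factorizations yields the differential equations of
   Chebyshev type whose coefficientwise form is the recurrences of (d), (e). *)
Require Import Defs.
From HB Require Import structures.
From mathcomp Require Import all_boot all_order all_algebra all_solvable all_field.
From mathcomp Require Import all_classical all_reals exp.
From mathcomp Require Import zify ring lra.
From Stdlib Require Import Classical.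

Set Implicit Arguments.
Unset Strict Implicit.
Unset Printing Implicit Defensive.

Import Order.TTheory GRing.Theory Num.Theory.
Local Open Scope ring_scope.

(** * Stepanov's method *)

Lemma size_mul_bound (R : nzRingType) (a b : nat) (p q : {poly R}) :
  (size p <= a.+1)%N -> (size q <= b)%N -> (size (p * q)%R <= a + b)%N.
Proof. by move=> ha hb; apply: leq_trans (size_polyMleq _ _) _; lia. Qed.

Lemma size_exp_bound (R : nzRingType) (m i : nat) (p : {poly R}) :
  (size p <= m.+1)%N -> (size (p ^+ i)%R <= (i * m).+1)%N.
Proof.
move=> hp; apply: leq_trans (size_poly_exp_leq _ _) _.
by rewrite ltnS mulnC leq_mul2l; apply/orP; right; lia.
Qed.

Lemma pigeonhole (T T' : finType) (h : T -> T') : (#|T'| < #|T|)%N ->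
  exists x y, x != y /\ h x = h y.
Proof.
rewrite ltnNge => hlt; have /injectivePn[x [y xy hxy]] : ~~ injectiveb h.
  by apply: contra hlt => /injectiveP /leq_card.
by exists x, y.
Qed.

(** * Hasse derivatives *)

Section Hasse.
Variable R : idomainType.
Implicit Types (p f r : {poly R}).

(** The coefficient of the [k]-th power of the increment in the Taylor expansion. Unlike the
    iterated derivative it carries no factor [k!], which vanishes in characteristic [p] once
    [k >= p]. *)
Definition hasse (k : nat) (p : {poly R}) : {poly R} := (poly_XaY p)`_k.

Lemma poly_XaYD p1 p2 : poly_XaY (p1 + p2) = poly_XaY p1 + poly_XaY p2.
Proof. by rewrite /poly_XaY !rmorphD. Qed.

Lemma poly_XaYB p1 p2 : poly_XaY (p1 - p2) = poly_XaY p1 - poly_XaY p2.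
Proof. by rewrite /poly_XaY !rmorphB. Qed.

Lemma poly_XaYM p1 p2 : poly_XaY (p1 * p2) = poly_XaY p1 * poly_XaY p2.
Proof. by rewrite /poly_XaY !rmorphM. Qed.

Lemma poly_XaYC c : poly_XaY c%:P = c%:P%:P :> {poly {poly R}}.
Proof. by rewrite /poly_XaY map_polyC comp_polyC. Qed.

Lemma poly_XaYX : poly_XaY 'X = 'X + 'X%:P :> {poly {poly R}}.
Proof. by rewrite /poly_XaY map_polyX comp_polyX. Qed.

Lemma hasseD k p1 p2 : hasse k (p1 + p2) = hasse k p1 + hasse k p2.
Proof. by rewrite /hasse poly_XaYD coefD. Qed.

Lemma hasseB k p1 p2 : hasse k (p1 - p2) = hasse k p1 - hasse k p2.
Proof. by rewrite /hasse poly_XaYB coefB. Qed.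

Lemma hasseM k p1 p2 :
  hasse k (p1 * p2) = \sum_(i < k.+1) hasse i p1 * hasse (k - i) p2.
Proof. by rewrite /hasse poly_XaYM coefM. Qed.

Lemma hasse0 p : hasse 0 p = p.
Proof.
rewrite /hasse -horner_coef0 /poly_XaY horner_comp.
by rewrite hornerD hornerX hornerC add0r -/(comp_poly 'X p) comp_polyXr.
Qed.

Lemma size_hasse k p : (size (hasse k p) <= size p)%N.
Proof.
elim/poly_ind: p k => [|p c IH] k; first by rewrite /hasse poly_XaY0 coef0.
have [->|p0] := eqVneq p 0.
  rewrite mul0r add0r /hasse poly_XaYC coefC.
  by case: ifP; rewrite ?size_poly0.
have -> : hasse k (p * 'X + c%:P)
    = (if k is k'.+1 then hasse k' p else 0) + hasse k p * 'X
      + (if k is 0%N then c%:P else 0).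
  rewrite hasseD /hasse poly_XaYM poly_XaYX poly_XaYC mulrDr coefD coefMX coefMC.
  by rewrite coefC; case: k.
rewrite size_MXaddC (negbTE p0) /=.
have h1 : (size (hasse k p * 'X)%R <= (size p).+1)%N.
  by apply: leq_trans (size_polyMleq _ _) _; rewrite size_polyX addn2 ltnS.
have h2 : (size ((if k is k'.+1 then hasse k' p else 0%R) : {poly R}) <= (size p).+1)%N.
  by case: k {h1} => [|k]; rewrite ?size_poly0 // leqW.
have h3 : (size ((if k is 0%N then c%:P else 0%R) : {poly R}) <= (size p).+1)%N.
  by case: k {h1 h2} => [|k]; rewrite ?size_poly0 // (leq_trans (size_polyC_leq1 _)).
apply: leq_trans (size_polyD _ _) _; rewrite geq_max h3 andbT.
by apply: leq_trans (size_polyD _ _) _; rewrite geq_max h2.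
Qed.

(** Specializing the inner variable of [poly_XaY p] to [x] gives the Taylor expansion of [p] at [x],
    so vanishing orders at [x] can be read off from Hasse derivatives. *)
Lemma coef_comp_XaddC p x k : (p \Po ('X + x%:P))`_k = (hasse k p).[x].
Proof.
have -> : p \Po ('X + x%:P) = map_poly (horner_eval x) (poly_XaY p).
  rewrite /poly_XaY map_comp_poly rmorphD /= map_polyX map_polyC /=.
  rewrite horner_evalE hornerX; congr (_ \Po _).
  apply/polyP => i; rewrite !coef_map /=.
  by rewrite horner_evalE hornerC.
by rewrite coef_map.
Qed.

(* The first [l] Hasse derivatives of [f ^+ l * r] keep the factor
   [f ^+ (l - k)], and the cofactor grows in degree only like [k * deg f]. *)
Lemma hasse_pow (f r : {poly R}) (m l k : nat) :
  (size f <= m.+1)%N -> (k <= l)%N ->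
  exists2 Q : {poly R}, hasse k (f ^+ l * r) = f ^+ (l - k) * Q
    & (size Q <= k * m + size r)%N.
Proof.
move=> hf; elim: l k => [|l IH] k.
  rewrite leqn0 => /eqP ->; exists r; last by [].
  by rewrite hasse0.
rewrite leq_eqVlt => /orP[/eqP ->|hk].
  exists (hasse l.+1 (f ^+ l.+1 * r)); first by rewrite subnn expr0 mul1r.
  apply: leq_trans (size_hasse _ _) _.
  by apply: size_mul_bound => //; apply: size_exp_bound.
rewrite exprS -mulrA hasseM.
pose good (P : {poly R}) := exists2 Q : {poly R}, P = f ^+ (l.+1 - k) * Q
    & (size Q <= k * m + size r)%N.
rewrite -/(good _); apply: big_ind => [|P1 P2 [Q1 -> h1] [Q2 -> h2]|i _].
- by exists 0; rewrite ?mulr0 // size_poly0.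
- exists (Q1 + Q2); rewrite ?mulrDr //.
  by apply: leq_trans (size_polyD _ _) _; rewrite geq_max h1.
have [|Q -> hQ] := IH (k - i)%N; first by lia.
have hik : (i <= k)%N by rewrite -ltnS.
case: (posnP i) => [i0|i0].
  rewrite i0 subn0 in hQ *; exists Q; last by [].
  by rewrite hasse0 mulrA -exprS subSn.
(* For [i > 0] the induction hypothesis supplies [i - 1] more factors [f] than required; they are
   absorbed in the cofactor, within the allowance [k * m]. *)
exists (f ^+ i.-1 * (hasse i f * Q)).
  have -> : (l - (k - i) = (l.+1 - k) + i.-1)%N by lia.
  by rewrite exprD; ring.
have h1 := size_mul_bound (leq_trans (size_hasse i f) hf) hQ.
have := size_mul_bound (size_exp_bound i.-1 hf) h1.
move/leq_trans; apply; rewrite mulnBl.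
by case: (nat_of_ord i) i0 hik => //= i' _ hik; nia.
Qed.

End Hasse.

(* In the field of fractions: [f] is not a constant times [(s / r) ^+ 2]. *)
Definition nonsquare (F : fieldType) (f : {poly F}) : Prop :=
  forall (c : F) (r s : {poly F}), r ^+ 2 * f = c *: s ^+ 2 -> c != 0 -> r = 0.

Lemma nonsquare_neq0 (F : fieldType) (f : {poly F}) : nonsquare f -> f != 0.
Proof.
move=> fns; apply/eqP => f0; have := fns 1 1 0.
rewrite f0 mulr0 expr0n scaler0 => /(_ erefl (oner_neq0 _)) /eqP.
by rewrite oner_eq0.
Qed.

Lemma nonsquare_comp (F : fieldType) (f : {poly F}) (a : F) :
  nonsquare f -> nonsquare (f \Po ('X + a%:P)).
Proof.
have K (u : {poly F}) : (u \Po ('X - a%:P)) \Po ('X + a%:P) = u.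
  by rewrite -comp_polyA rmorphB /= comp_polyX comp_polyC addrK comp_polyXr.
have K' (u : {poly F}) : (u \Po ('X + a%:P)) \Po ('X - a%:P) = u.
  by rewrite -comp_polyA rmorphD /= comp_polyX comp_polyC subrK comp_polyXr.
move=> fns c r s e c0; rewrite -(K r) (fns c (r \Po ('X - a%:P)) (s \Po ('X - a%:P))) //.
  by rewrite comp_poly0.
rewrite -[in LHS](K' f) -rmorphXn -rmorphM e /=.
by rewrite comp_polyZ rmorphXn.
Qed.

(** * Auxiliary polynomials vanishing to high order *)

Section Stepanov.
Variables (F : finFieldType) (p a : nat).
Hypotheses (p_pr : prime p) (cardF : #|F| = (p ^ a)%N).
Let q := #|F|.

Lemma pnat_card_poly : [pchar {poly F}].-nat q.
Proof.
have pF : p \in [pchar F] by apply: card_finPcharP cardF p_pr.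
rewrite /q cardF pnatX; apply/orP; left.
rewrite (eq_pnat _ (pcharf_eq (R := {poly F}) (p := p) _)) ?pnat_id //.
by rewrite pchar_poly.
Qed.

Lemma expXaddC_card (x : F) : ('X + x%:P) ^+ q = 'X^q + x%:P.
Proof. by rewrite (exprDn_pchar _ _ pnat_card_poly) -polyC_exp expf_card. Qed.

Lemma expp_card (f : {poly F}) : f ^+ q = f \Po 'X^q.
Proof.
elim/poly_ind: f => [|f c IH].
  by rewrite comp_poly0 expr0n gtn_eqF // /q; apply/card_gt0P; exists 0.
rewrite (exprDn_pchar _ _ pnat_card_poly) -polyC_exp expf_card exprMn IH.
by rewrite rmorphD rmorphM /= comp_polyX comp_polyC.
Qed.

Variables (g m n : nat) (f : {poly F}).
Hypotheses (qE : q = g.*2.+1) (fns : nonsquare f).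
Hypotheses (szf : (size f <= m.+1)%N) (f0 : f.[0] != 0).
Hypotheses (n_gt0 : (0 < n)%N) (hn : (n.*2 + m <= q)%N).

(** Multiplying by [(r - f ^+ g * s) * f] gives [r ^+ 2 * f - f ^+ q * s ^+ 2], and
    [f ^+ q = f \Po 'X^q] is [f.[0]] modulo ['X^q]. Hence ['X^q] divides [r ^+ 2 * f - f.[0] *: s ^+
    2], whose degree is below [q]; it vanishes, and [f] being nonsquare forces [r = 0]. *)
Lemma stepanov_core (r s : {poly F}) :
  (size r <= n)%N -> (size s <= n)%N ->
  'X^q %| r + f ^+ g * s -> r = 0 /\ s = 0.
Proof.
move=> hr hs dv.
have qgt0 : (0 < q)%N by rewrite qE.
have dv1 : 'X^q %| r ^+ 2 * f - f.[0] *: s ^+ 2.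
  have -> : r ^+ 2 * f - f.[0] *: s ^+ 2
     = (r + f ^+ g * s) * ((r - f ^+ g * s) * f) + (f ^+ q - (f.[0])%:P) * s ^+ 2.
    rewrite -mul_polyC qE [f ^+ _.+1]exprS -addnn exprD; ring.
  apply: dvdp_add; first exact: dvdp_mulr.
  apply: dvdp_mulr; rewrite expp_card.
  have -> : f \Po 'X^q - (f.[0])%:P = (f - (f.[0])%:P) \Po 'X^q.
    by rewrite rmorphB /= comp_polyC.
  have /factor_theorem [h ->] : root (f - (f.[0])%:P) 0.
    by rewrite rootE !hornerE subrr.
  by rewrite rmorphM /= polyC0 subr0 comp_polyX dvdp_mull.
have e : r ^+ 2 * f - f.[0] *: s ^+ 2 = 0.
  apply/eqP; apply: contraTT dv1 => nz; apply/negP => /(dvdp_leq nz).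
  rewrite size_polyXn; apply/negP; rewrite -leqNgt.
  apply: leq_trans (size_polyD _ _) _; rewrite size_polyN geq_max; apply/andP; split.
    have h2 : (size (r ^+ 2) <= (n.-1.*2).+1)%N.
      rewrite -muln2 mulnC; apply: size_exp_bound.
      by rewrite prednK.
    by apply: leq_trans (size_mul_bound h2 szf) _; lia.
  apply: leq_trans (size_scale_leq _ _) _.
  have : (size (s ^+ 2) <= (2 * n.-1).+1)%N.
    by apply: size_exp_bound; rewrite prednK.
  move/leq_trans; apply; lia.
move/eqP: e; rewrite subr_eq0 => /eqP e.
have r0 := fns e f0; split => //; move/eqP: e; rewrite r0 expr0n mul0r eq_sym.
by rewrite scaler_eq0 (negbTE f0) sqrf_eq0 => /eqP.
Qed.

(** Reduction modulo ['X^q] isolates the block [j = 0]; once it is zero, the sum is divided by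
    ['X^q] and the next block comes first. *)
Lemma stepanov_indep J (r s : nat -> {poly F}) :
  (forall j, (size (r j) <= n)%N) -> (forall j, (size (s j) <= n)%N) ->
  \sum_(j < J) (r j + f ^+ g * s j) * 'X^(j * q) = 0 ->
  forall j, (j < J)%N -> r j = 0 /\ s j = 0.
Proof.
elim: J r s => // J IH r s hr hs.
rewrite big_ord_recl mul0n expr0 mulr1 => e.
have {}e : (r 0%N + f ^+ g * s 0%N)
    + (\sum_(j < J) (r j.+1 + f ^+ g * s j.+1) * 'X^(j * q)) * 'X^q = 0.
  rewrite -[RHS]e; congr (_ + _); rewrite mulr_suml; apply: eq_bigr => j _.
  by rewrite -mulrA -exprD mulSn addnC.
have [r0 s0] : r 0%N = 0 /\ s 0%N = 0.
  apply: stepanov_core => //; move/eqP: e; rewrite addr_eq0 => /eqP ->.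
  by rewrite -mulNr dvdp_mull.
move/eqP: e; rewrite r0 s0 mulr0 !add0r mulf_eq0 -size_poly_eq0 orbC.
rewrite -[X in X || _]size_poly_eq0 size_polyXn /= size_poly_eq0 => /eqP e.
move=> [|j] // hj; exact: (IH (fun j => r j.+1) (fun j => s j.+1)).
Qed.

Variables (eps : F) (l J : nat).
Hypothesis (l_le_q : (l <= q)%N).
Hypothesis (count : (l * (l * m + n + J) < J * n.*2)%N).

(** The cofactor from [hasse_pow], obtained by division so that it is visibly additive in [u]. *)
Definition reduced_hasse (e k : nat) (u : {poly F}) : {poly F} :=
  hasse k (f ^+ e * u) %/ f ^+ (e - k).

Lemma reduced_hasseB e k u v :
  reduced_hasse e k (u - v) = reduced_hasse e k u - reduced_hasse e k v.
Proof. by rewrite /reduced_hasse mulrBr hasseB divpD divpN. Qed.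

Lemma reduced_hasseP e k u : (k <= e)%N ->
  hasse k (f ^+ e * u) = f ^+ (e - k) * reduced_hasse e k u.
Proof.
move=> hk; rewrite /reduced_hasse; have [Q -> _] := hasse_pow u szf hk.
by rewrite mulKp ?expf_neq0 ?nonsquare_neq0.
Qed.

Lemma size_reduced_hasse e k u : (k <= e)%N ->
  (size (reduced_hasse e k u) <= k * m + size u)%N.
Proof.
move=> hk; rewrite /reduced_hasse; have [Q -> hQ] := hasse_pow u szf hk.
by rewrite mulKp ?expf_neq0 ?nonsquare_neq0.
Qed.

Definition row_poly (U : 'M[F]_(J, n)) (j : 'I_J) := rVpoly (row j U).

Lemma size_row_poly U j : (size (row_poly U j) <= n)%N.
Proof. exact: size_poly. Qed.

(* At a point [x] of [F] with [f.[x] ^+ g = eps], the [k]-th Hasse derivative of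
   [auxpoly U] below is [f.[x] ^+ (l - k) * (jet k U).[x]], because [x ^+ q = x]. *)
Definition jet (k : nat) (U : 'M[F]_(J, n) * 'M[F]_(J, n)) : {poly F} :=
  \sum_(j < J) (reduced_hasse l k (row_poly U.1 j)
     + eps *: reduced_hasse (l + g) k (row_poly U.2 j)) * 'X^j.

Lemma jetB k U V : jet k (U - V) = jet k U - jet k V.
Proof.
rewrite /jet -sumrB; apply: eq_bigr => j _; rewrite -mulrBl; congr (_ * _).
have rB (A B : 'M[F]_(J, n)) : row_poly (A - B) j = row_poly A j - row_poly B j.
  by rewrite /row_poly !linearB.
case: U V => U1 U2 [V1 V2].
rewrite -[((U1, U2) - (V1, V2)).1]/(U1 - V1) -[((U1, U2) - (V1, V2)).2]/(U2 - V2).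
by rewrite [LHS]/= !rB !reduced_hasseB scalerBr opprD addrACA.
Qed.

Lemma size_jet k U : (k < l)%N -> (size (jet k U) <= l * m + n + J)%N.
Proof.
move=> hk; apply: leq_trans (size_sum _ _ _) _; apply/bigmax_leqP => j _.
have h (e : nat) A : (l <= e)%N -> (size (reduced_hasse e k (row_poly A j)) <= l * m + n)%N.
  move=> he; apply: leq_trans (size_reduced_hasse _ _) _; first by lia.
  by rewrite leq_add ?size_row_poly // leq_mul2r ltnW ?orbT.
rewrite mulrC [leqRHS]addnC; apply: (@size_mul_bound _ J).
  by rewrite size_polyXn ltnS; exact: ltnW (ltn_ord j).
apply: leq_trans (size_polyD _ _) _; rewrite geq_max h //=.
by apply: leq_trans (size_scale_leq _ _) _; rewrite h ?leq_addr.
Qed.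

(** By [count] there are more pairs of matrices than possible lists of coefficients of the first [l]
    jets. Two pairs collide, and their difference works since jets are additive. *)
Lemma jet_vanish : exists2 U, U != 0 & forall k, (k < l)%N -> jet k U = 0.
Proof.
pose phi (U : 'M[F]_(J, n) * 'M[F]_(J, n)) : 'M[F]_(l, l * m + n + J) :=
  \matrix_(i, j) (jet i U)`_j.
have phiE W (i : 'I_l) (j : 'I__) : phi W i j = (jet i W)`_j by rewrite mxE.
have [|U [V [UV e]]] := @pigeonhole _ _ phi.
  rewrite card_prod !card_mx -expnD ltn_exp2l; first by rewrite addnn doubleMr count.
  by apply: (@leq_trans #|[:: (0 : F); 1]|); rewrite ?max_card //=
    (card_uniqP _) //= inE eq_sym oner_eq0.
exists (U - V); first by rewrite subr_eq0.
move=> i hi; rewrite jetB; apply/eqP; rewrite subr_eq0; apply/eqP/polyP => j.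
case: (ltnP j (l * m + n + J)) => hj.
  by rewrite -[in LHS](phiE U (Ordinal hi) (Ordinal hj)) e phiE.
move: (jet i U) (jet i V) (size_jet U hi) (size_jet V hi) => A B hA hB.
by rewrite (nth_default 0 (leq_trans hA hj)) (nth_default 0 (leq_trans hB hj)).
Qed.

Definition auxpoly (U : 'M[F]_(J, n) * 'M[F]_(J, n)) : {poly F} :=
  \sum_(j < J) (f ^+ l * row_poly U.1 j + f ^+ (l + g) * row_poly U.2 j)
     * 'X^(j * q).

Lemma auxpoly_neq0 U : U != 0 -> auxpoly U != 0.
Proof.
apply: contraNN => /eqP e.
(* Rows are extended by zero to all natural indices, the form in which [stepanov_indep] shifts
   them. *)
pose ext (A : 'M[F]_(J, n)) (j : nat) := if insub j is Some i then row_poly A i else 0.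
have extE A (j : 'I_J) : ext A j = row_poly A j by rewrite /ext valK.
have sz_ext A j : (size (ext A j) <= n)%N.
  by rewrite /ext; case: insubP => [i _ _|_]; rewrite ?size_row_poly ?size_poly0.
have {}e : \sum_(j < J) (ext U.1 j + f ^+ g * ext U.2 j) * 'X^(j * q) = 0.
  have : f ^+ l * (\sum_(j < J) (ext U.1 j + f ^+ g * ext U.2 j) * 'X^(j * q)) = 0.
    rewrite -[RHS]e mulr_sumr; apply: eq_bigr => j _.
    by rewrite !extE exprD; ring.
  by move/eqP; rewrite mulf_eq0 expf_eq0 (negbTE (nonsquare_neq0 fns)) andbF /= => /eqP.
have H := stepanov_indep (sz_ext U.1) (sz_ext U.2) e.
have z A : (forall j : 'I_J, ext A j = 0) -> A = 0.
  move=> h; apply/row_matrixP => j; rewrite row0 -[LHS]rVpolyK.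
  by rewrite -/(row_poly A j) -extE h raddf0.
have := z _ (fun j => (H j (ltn_ord j)).1); have := z _ (fun j => (H j (ltn_ord j)).2).
by case: U {e H} => A B /= -> ->.
Qed.

Lemma coef_mul_XnaddC (P : {poly F}) (x : F) (i j : nat) : (i < q)%N ->
  (P * ('X^q + x%:P) ^+ j)`_i = P`_i * x ^+ j.
Proof.
move=> hi; elim: j P => [|j IH] P; first by rewrite !expr0 !mulr1.
rewrite exprS mulrA IH mulrDr coefD coefMXn hi add0r coefMC exprS; ring.
Qed.

(** After translating [x] to [0], the power ['X^(j * q)] becomes [('X^q + x%:P) ^+ j], which acts as
    the constant [x ^+ j] on coefficients below [q]. As [l <= q], the coefficient of index [i < l]
    is [f.[x] ^+ (l - i)] times the value of the [i]-th jet at [x]. *)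
Lemma auxpoly_root U x : (forall k, (k < l)%N -> jet k U = 0) ->
  f.[x] ^+ g = eps -> ('X - x%:P) ^+ l %| auxpoly U.
Proof.
move=> hU hx.
have : 'X^l %| auxpoly U \Po ('X + x%:P).
  rewrite /dvdp -Pdiv.IdomainMonic.take_poly_modp; apply/eqP/polyP => i.
  rewrite coef0 coef_take_poly.
  case: ifP => // hi; rewrite /auxpoly rmorph_sum coef_sum /=.
  have hiq : (i < q)%N := leq_trans hi l_le_q.
  transitivity (\sum_(j < J) f.[x] ^+ (l - i) * ((reduced_hasse l i (row_poly U.1 j)
     + eps *: reduced_hasse (l + g) i (row_poly U.2 j)) * 'X^j).[x]).
    apply: eq_bigr => j _; rewrite rmorphM /= comp_Xn_poly.
    rewrite mulnC exprM expXaddC_card coef_mul_XnaddC // coef_comp_XaddC.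
    rewrite hasseD (reduced_hasseP _ (ltnW hi)) reduced_hasseP; last by lia.
    have -> : (l + g - i = (l - i) + g)%N by lia.
    rewrite !hornerE exprD hx [RHS]/=; ring.
  by rewrite -mulr_sumr -horner_sum -/(jet i U) hU // horner0 mulr0.
case/dvdpP => h /(congr1 (fun u => u \Po ('X - x%:P))).
rewrite -comp_polyA rmorphD /= comp_polyX comp_polyC subrK comp_polyXr => ->.
by rewrite rmorphM /= comp_Xn_poly dvdp_mull.
Qed.

Lemma prod_exp_XsubC_dvd (s : seq F) (P : {poly F}) e : uniq s ->
  (forall x, x \in s -> ('X - x%:P) ^+ e %| P) ->
  \prod_(x <- s) ('X - x%:P) ^+ e %| P.
Proof.
elim: s => [|x s IH] /=; first by rewrite big_nil dvd1p.
case/andP=> xs us H; rewrite big_cons Gauss_dvdp; last first.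
  apply: coprimep_expl; rewrite coprimep_sym coprimep_XsubC /root.
  rewrite prodrXl horner_exp horner_prod expf_neq0 // prodf_seq_neq0.
  apply/allP => y ys; rewrite hornerXsubC subr_eq0 /=.
  by apply: contraNneq xs => ->.
rewrite H ?mem_head //= IH // => y ys; apply: H; by rewrite inE ys orbT.
Qed.

Lemma size_auxpoly U : (size (auxpoly U) <= (l + g) * m + n + J * q)%N.
Proof.
apply: leq_trans (size_sum _ _ _) _; apply/bigmax_leqP => j _.
have h e A : (e <= l + g)%N ->
    (size (f ^+ e * row_poly A j)%R <= (l + g) * m + n)%N.
  move=> he; apply: leq_trans (size_mul_bound (size_exp_bound e szf) (size_row_poly A j)) _.
  by rewrite leq_add2r leq_mul2r he orbT.
rewrite mulrC [leqRHS]addnC; apply: (@size_mul_bound _ (J * q)).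
  by rewrite size_polyXn ltnS leq_mul2r [(j <= J)%N]ltnW ?orbT.
by apply: leq_trans (size_polyD _ _) _; rewrite geq_max !h ?leq_addr.
Qed.

(** Each point counted is a zero of order at least [l] of a nonzero auxiliary polynomial, whose size
    bounds the total. *)
Lemma stepanov :
  (#|[set x : F | f.[x] ^+ g == eps]| * l < (l + g) * m + n + J * q)%N.
Proof.
have [U U0 hU] := jet_vanish; set Z := [set x | _].
have dv : \prod_(x <- enum Z) ('X - x%:P) ^+ l %| auxpoly U.
  apply: prod_exp_XsubC_dvd; rewrite ?enum_uniq // => x.
  by rewrite mem_enum inE => /eqP; apply: auxpoly_root.
have := leq_trans (dvdp_leq (auxpoly_neq0 U0) dv) (size_auxpoly U).
rewrite prodrXl -(prednK (n := size _)); last first.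
  by rewrite size_poly_gt0 expf_neq0 // monic_neq0 // monic_prod_XsubC.
by rewrite size_exp size_prod_XsubC /= -cardE.
Qed.

End Stepanov.

(** Translations serve to arrange [f.[0] != 0], as the construction above demands. *)
Lemma card_translate (F : finFieldType) (f : {poly F}) (P : pred F) (b : F) :
  #|[set x | P (f \Po ('X + b%:P)).[x]]| = #|[set x | P f.[x]]|.
Proof.
have shift (x : F) : (f \Po ('X + b%:P)).[x] = f.[x + b].
  by rewrite horner_comp !hornerE.
rewrite -(card_imset _ (addIr b)); congr #|pred_of_set _|; apply/setP => y.
apply/imsetP/idP => [[x]|]; rewrite inE.
  by rewrite shift => h ->; rewrite inE.
by move=> h; exists (y - b); rewrite ?subrK // inE shift subrK.
Qed.

Lemma nonroot_exists (F : finFieldType) (f : {poly F}) :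
  f != 0 -> (size f <= #|F|)%N -> exists b, f.[b] != 0.
Proof.
move=> f0 hs; case: (pickP (fun b => f.[b] != 0)) => [b hb|H]; first by exists b.
have hall : all (root f) (enum F) by apply/allP => x _; have /negbFE := H x.
by have := max_poly_roots f0 hall (enum_uniq F); rewrite -cardE ltnNge hs.
Qed.

(** The order of vanishing is [s], about the square root of [q], with [n] about [q / 2] and [J]
    about [s / 2]. The size of the auxiliary polynomial is then [q * s / 2] up to [O(m * q)];
    dividing by [s] leaves [q / 2 + O(m * s)]. *)
Lemma stepanov_bound (F : finFieldType) (p a g m s : nat) (f : {poly F}) (eps : F) :
  prime p -> #|F| = (p ^ a)%N -> #|F| = g.*2.+1 ->
  nonsquare f -> (0 < m)%N -> (size f <= m.+1)%N ->
  (s ^ 2 <= #|F| < s.+1 ^ 2)%N ->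
  (#|[set x : F | f.[x] ^+ g == eps]|.*2 <= #|F| + 40 * m * s)%N.
Proof.
move=> p_pr cF qE fns m0 szf /andP[sq1 sq2].
set N := #|_|; have Nq : (N <= #|F|)%N by rewrite max_card.
have s0 : (0 < s)%N by case: s sq1 sq2 => //; rewrite qE.
(* If [s <= 10 * m], then [q <= 40 * m * s] and the trivial bound by [q] suffices. *)
have [hm|hm] := leqP s (10 * m)%N; first by nia.
have fz := nonsquare_neq0 fns.
have [b hb] : exists b, f.[b] != 0.
  by apply: nonroot_exists fz _; apply: leq_trans szf _; nia.
pose h := f \Po ('X + b%:P).
have hns : nonsquare h := nonsquare_comp fns.
have hsz : (size h <= m.+1)%N.
  by rewrite size_comp_poly2 // size_XaddC.
have h0 : h.[0] != 0 by rewrite horner_comp !hornerE.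
rewrite {}/N -(card_translate f (fun y => y ^+ g == eps) b) -/h in Nq *.
(* The excess [3 * m + 1] of [J] over [s / 2] makes the [J * n.*2] unknowns outnumber the
   [s * (s * m + n + J)] conditions. *)
pose n := ((#|F| - m)./2)%N; pose J := (s./2 + 3 * m + 1)%N.
have n1 : (n.*2 <= #|F| - m <= n.*2.+1)%N.
  by rewrite /n; move: (#|F| - m)%N => t; lia.
have J1 : (s + 6 * m < J.*2 <= s + 6 * m + 2)%N by rewrite /J; lia.
have ng0 : (0 < n)%N by nia.
have hn : (n.*2 + m <= #|F|)%N by nia.
have sq : (s <= #|F|)%N by nia.
have cnt : (s * (s * m + n + J) < J * n.*2)%N by nia.
have := stepanov p_pr cF qE hns hsz h0 ng0 hn eps sq cnt.
by move: Nq; set N := #|_|; nia.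
Qed.

(** * Quadratic character sums *)

Section QuadChar.
Variables (F : finFieldType) (g : nat).
Hypothesis qE : #|F| = g.*2.+1.

Lemma half_gt0 : (0 < g)%N.
Proof.
rewrite lt0n; apply/eqP => g0; have := card_uniqP (s := [:: (0 : F); 1]).
rewrite /= inE eq_sym oner_eq0 => /(_ isT) c.
by have := max_card (mem [:: (0 : F); 1]); rewrite c qE g0.
Qed.

Lemma expf_double_half (x : F) : x != 0 -> x ^+ g.*2 = 1.
Proof. by move=> x0; apply: (mulfI x0); rewrite -exprS -qE expf_card mulr1. Qed.

(** The nonzero elements are [g.*2] distinct roots of unity of that order, so one of them, [w], is
    primitive. If [x = w ^+ i], then [g.*2] divides [i * g], so [i] is even. *)
Lemma nonsquare_exp_half (x : F) : x ^+ g = 1 -> exists y, y ^+ 2 = x.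
Proof.
move=> xg; have g0 := half_gt0.
have /hasP[w _ pw] : has (g.*2).-primitive_root [seq x <- enum F | x != 0].
  apply: has_prim_root; first by rewrite double_gt0.
  - apply/allP => z; rewrite mem_filter => /andP[z0 _].
    by rewrite unity_rootE expf_double_half.
  - by rewrite filter_uniq ?enum_uniq.
  have := count_predC (pred1 (0 : F)) (enum F).
  rewrite count_uniq_mem ?enum_uniq // mem_enum inE -cardE qE add1n size_filter.
  by case=> <-.
have [|[i _] /= xi] := prim_rootP pw (x := x); first by rewrite -muln2 exprM xg expr1n.
move: xg; rewrite xi -exprM => /eqP; rewrite -(prim_order_dvd pw) {xi}.
rewrite -mul2n dvdn_pmul2r // dvdn2 => hi; exists (w ^+ i./2).
by rewrite -exprM muln2 even_halfK.
Qed.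

(** Euler's criterion. *)
Lemma quad_charE (x : F) : (quad_char x)%:~R = x ^+ g.
Proof.
rewrite /quad_char; have [->|x0] := eqVneq x 0.
  by rewrite expr0n gtn_eqF ?half_gt0.
case: ifPn => [/existsP[y /eqP yx]|/existsPn H].
  rewrite -yx -exprM mul2n expf_double_half //.
  by apply: contraNneq x0 => y0; rewrite -yx y0 expr0n.
have : (x ^+ g) ^+ 2 == 1 by rewrite -exprM muln2 expf_double_half.
rewrite sqrf_eq1 => /orP[/eqP /nonsquare_exp_half [y yx]|/eqP -> //].
by have := H y; rewrite yx eqxx.
Qed.

Lemma quad_char_cases (x : F) :
  [\/ quad_char x = 0, quad_char x = 1 | quad_char x = -1].
Proof.
by rewrite /quad_char; case: eqP => _; [constructor 1|case: ifP; [constructor 2|constructor 3]].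
Qed.

Variables (p a : nat).
Hypotheses (p_pr : prime p) (cardF : #|F| = (p ^ a)%N).

Lemma two_neq0 : (2 : F) != 0.
Proof.
have pF : p \in [pchar F] by apply: card_finPcharP cardF p_pr.
rewrite -(dvdn_pcharf pF); apply/negP => p2.
have /eqP p_eq2 : p == 2 by rewrite -dvdn_prime2.
have := congr1 odd qE; rewrite /= odd_double cardF oddX p_eq2 orbF => /eqP a0.
by have := half_gt0; move: qE; rewrite cardF a0 expn0; lia.
Qed.

(** In odd characteristic [0], [1] and [-1] stay distinct in [F], so identities between characters
    may be checked there, on powers. *)
Lemma quad_char_inj (n1 n2 : int) :
  [\/ n1 = 0, n1 = 1 | n1 = -1] -> [\/ n2 = 0, n2 = 1 | n2 = -1] ->
  n1%:~R = n2%:~R :> F -> n1 = n2.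
Proof.
have h2 := two_neq0; have h1 := oner_neq0 F.
have h3 : (1 : F) != -1 by rewrite -subr_eq0 opprK.
case=> ->; case=> -> // /eqP; rewrite ?rmorphN /= ?mulr0z ?mulr1z.
- by rewrite eq_sym (negbTE h1).
- by rewrite eq_sym oppr_eq0 (negbTE h1).
- by rewrite (negbTE h1).
- by rewrite (negbTE h3).
- by rewrite oppr_eq0 (negbTE h1).
- by rewrite eq_sym (negbTE h3).
Qed.

Lemma quad_charM (x y : F) : quad_char (x * y) = quad_char x * quad_char y.
Proof.
apply: quad_char_inj; first exact: quad_char_cases.
  case: (quad_char_cases x) => ->; case: (quad_char_cases y) => ->;
    by [constructor 1|constructor 2|constructor 3].
by rewrite rmorphM /= !quad_charE exprMn.
Qed.

Lemma quad_char_prod (I : finType) (P : pred I) (h : I -> F) :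
  quad_char (\prod_(i | P i) h i) = \prod_(i | P i) quad_char (h i).
Proof.
have q1 : quad_char (1 : F) = 1.
  by apply: quad_char_inj (quad_char_cases _) (Or32 _ _ erefl) _; rewrite quad_charE expr1n.
by rewrite (big_morph (@quad_char F) quad_charM q1).
Qed.

(** Stepanov's bound caps the count of either sign at [q / 2 + O(m * s)]. The three counts add up to
    [q] and that of value [0] is at most [m], so an upper bound for one sign is a lower bound for
    the other. *)
Lemma quad_char_sum_bound (f : {poly F}) (m s : nat) :
  nonsquare f -> (0 < m)%N -> (size f <= m.+1)%N -> (s ^ 2 <= #|F| < s.+1 ^ 2)%N ->
  `|\sum_(x : F) quad_char f.[x]| <= (41 * m * s)%:Z.
Proof.
move=> fns m0 szf sq.
have bound (e : int) : [\/ e = 0, e = 1 | e = -1] ->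
   (#|[set x : F | quad_char f.[x] == e]|.*2 <= #|F| + 40 * m * s)%N.
  move=> he; have := stepanov_bound e%:~R p_pr cardF qE fns m0 szf sq.
  move=> h; apply: leq_trans h; rewrite leq_double; apply: subset_leq_card.
  by apply/fintype.subsetP => x; rewrite !inE => /eqP <-; rewrite quad_charE.
have s0 : (0 < s)%N by case: s sq {bound} => //; rewrite qE.
pose N e := #|[set x : F | quad_char f.[x] == e]|.
have N0 : (N 0%R <= m)%N.
  rewrite -ltnS; apply: leq_trans szf; rewrite /N cardE.
  apply: max_poly_roots (nonsquare_neq0 fns) _ (enum_uniq _).
  apply/allP => x; rewrite mem_enum inE /quad_char rootE.
  by case: ifP => // _; case: ifP.
have sum1 (e : int) : \sum_(x : F) ((quad_char f.[x] == e) : nat)%:Z = (N e)%:Z.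
  rewrite /N -sum1_card -(big_morph Posz PoszD erefl); congr Posz.
  by rewrite [RHS]big_mkcond; apply: eq_bigr => x _; rewrite inE; case: eqP.
have e1 : \sum_(x : F) quad_char f.[x] = (N 1)%:Z - (N (-1))%:Z.
  rewrite -!sum1 -sumrB; apply: eq_bigr => x _.
  by case: (quad_char_cases f.[x]) => ->.
have e2 : #|F|%:Z = (N 0)%:Z + (N 1)%:Z + (N (-1))%:Z.
  rewrite -!sum1 -!big_split /= -sum1_card (big_morph Posz PoszD erefl).
  by apply: eq_bigr => x _; case: (quad_char_cases f.[x]) => ->.
have b1 : ((N 1%R).*2 <= #|F| + 40 * m * s)%N by apply: bound; constructor 2.
have b2 : ((N (-1)%R).*2 <= #|F| + 40 * m * s)%N by apply: bound; constructor 3.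
rewrite e1; move: (N 1) (N (-1)) (N 0) N0 e2 b1 b2 => u v w {sum1 e1 bound}; nia.
Qed.

(** The weight [w] is nonnegative everywhere, also where some character vanishes, and equals
    [2 ^+ r] on the set counted. In its expansion the empty set contributes at most [q] and each
    other [S] at most [B]. *)
Lemma sign_pattern_count (r : nat) (G : 'I_r -> {poly F}) (u : 'I_r -> int) (B : nat) :
  (forall i, u i = 1 \/ u i = -1) ->
  (forall S : {set 'I_r}, S != finset.set0 ->
     `|\sum_(b : F) quad_char (\prod_(i in S) G i).[b]| <= B%:Z) ->
  (#|[set b : F | [forall i, quad_char (G i).[b] == u i]]| * 2 ^ r
     <= #|F| + 2 ^ r * B)%N.
Proof.
move=> hu hB; set A := [set b | _].
pose w (b : F) : int := \prod_(i < r) (u i * quad_char (G i).[b] + 1).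
have w_ge0 b : 0 <= w b.
  apply: prodr_ge0 => i _.
  by case: (hu i) => ->; case: (quad_char_cases (G i).[b]) => ->.
have wA b : b \in A -> w b = 2 ^+ r.
  rewrite inE => /forallP h; rewrite /w.
  rewrite (eq_bigr (fun=> 2)) ?prodr_const ?card_ord // => i _.
  by rewrite (eqP (h i)); case: (hu i) => ->.
have lower : (#|A| * 2 ^ r)%:Z <= \sum_(b : F) w b.
  rewrite (bigID (mem A)) /= (eq_bigr (fun=> 2 ^+ r)) => [|b hb]; last exact: wA.
  rewrite sumr_const.
  have -> : (#|A| * 2 ^ r)%:Z = 2 ^+ r *+ #|A| by rewrite PoszM -!natz natrX mulr_natl.
  by rewrite lerDl sumr_ge0.
have upper : \sum_(b : F) w b <= (#|F| + 2 ^ r * B)%:Z.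
  have wE b : w b = \sum_(S : {set 'I_r}) \prod_(i in S) u i
      * quad_char (\prod_(i in S) G i).[b].
    rewrite /w bigA_distr; apply: eq_bigr => S _.
    rewrite horner_prod quad_char_prod -big_split /= [RHS]big_mkcond.
    by apply: eq_bigr => i _; case: ifP.
  under eq_bigr do rewrite wE.
  rewrite exchange_big (bigD1 finset.set0) //=.
  rewrite PoszD; apply: lerD.
    rewrite -sum1_card (big_morph Posz PoszD erefl).
    apply: ler_sum => b _; rewrite !big_set0 mul1r.
    by case: (quad_char_cases (1 : {poly F}).[b]) => ->.
  apply: le_trans (_ : \sum_(S : {set 'I_r} | S != finset.set0) B%:Z <= _).
    apply: ler_sum => S S0; rewrite -mulr_sumr.
    apply: le_trans (ler_norm _) _; rewrite normrM normr_prod.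
    rewrite big1 ?mul1r ?hB // => i _.
    by case: (hu i) => ->; rewrite ?normrN normr1.
  rewrite sumr_const -mulr_natr mulrC natz -PoszM lez_nat leq_mul2r.
  apply/orP; right; apply: leq_trans (max_card _) _.
  by rewrite -cardsT -powersetT card_powerset cardsT card_ord.
by have := le_trans lower upper; rewrite lez_nat.
Qed.

End QuadChar.

(** * Odd-multiplicity roots and ramification *)

Section OddRoots.
Variable K : closedFieldType.
Implicit Types (P Q f : {poly K}) (x y : K).

Lemma mupX x Q n : Q != 0 -> mup x (Q ^+ n) = (n * mup x Q)%N.
Proof.
move=> Q0; elim: n => [|n IH]; first by rewrite expr0 mupNroot ?root1.
by rewrite exprS mupM ?expf_neq0 // IH mulSn.
Qed.

Lemma mupZ x (c : K) Q : c != 0 -> mup x (c *: Q) = mup x Q.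
Proof. by move=> c0; rewrite -mul_polyC mupMr // rootC. Qed.

Lemma odd_mup_root x Q : odd (mup x Q) -> root Q x.
Proof. by apply: contraTT => /mupNroot ->. Qed.

Lemma subC_neq0 P (y : K) : (1 < size P)%N -> P - y%:P != 0.
Proof.
move=> sP; rewrite -size_poly_gt0 size_polyDl ?size_polyN; first exact: ltnW.
by rewrite (leq_ltn_trans (size_polyC_leq1 _)).
Qed.

(** Multiplicativity of ramification indices: the part of [P] prime to ['X - (f.[x])%:P] does not
    vanish at [x] after composition. *)
Lemma mup_comp x P f : P != 0 -> (1 < size f)%N ->
  mup x (P \Po f) = (mup f.[x] P * mup x (f - (f.[x])%:P))%N.
Proof.
move=> P0 sf; have [m [Q]] := multiplicity_XsubC P f.[x].
rewrite P0 /= => Qx ->.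
have Q0 : Q != 0 by apply: contraNneq Qx => ->; rewrite root0.
have fx0 := subC_neq0 f.[x] sf.
rewrite mupMr ?mup_XsubCX ?eqxx // rmorphM rmorphXn /= rmorphB /= comp_polyX comp_polyC.
by rewrite mupMr ?mupX // /root horner_comp.
Qed.

Definition root_seq P : seq K := sval (closed_field_poly_normal P).

Lemma root_seqE P : P = lead_coef P *: \prod_(z <- root_seq P) ('X - z%:P).
Proof. exact: (svalP (closed_field_poly_normal P)). Qed.

Definition oddroots P : seq K :=
  [seq x <- undup (root_seq P) | odd (mup x P)].

Lemma oddroots_uniq P : uniq (oddroots P).
Proof. by rewrite filter_uniq ?undup_uniq. Qed.

Lemma mup_root_seq x P : P != 0 -> mup x P = count_mem x (root_seq P).
Proof.
by move=> P0; rewrite {1}(root_seqE P) mupZ ?lead_coef_eq0 // mu_prod_XsubC.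
Qed.

Lemma mem_oddroots P x : P != 0 -> (x \in oddroots P) = odd (mup x P).
Proof.
move=> P0; rewrite mem_filter mem_undup; case: (boolP (odd _)) => //= h.
rewrite -has_pred1 has_count -mup_root_seq //; exact: odd_gt0.
Qed.

(** Each multiplicity is split into its parity and twice its half. *)
Lemma oddroots_decomp P : P != 0 ->
  exists2 h, h \is monic &
    P = lead_coef P *: (\prod_(z <- oddroots P) ('X - z%:P) * h ^+ 2).
Proof.
move=> P0; exists (\prod_(z <- undup (root_seq P)) ('X - z%:P) ^+ (mup z P)./2).
  by apply: monic_prod => z _; rewrite monic_exp // monicXsubC.
rewrite {1}(root_seqE P); congr (_ *: _).
rewrite -prodr_undup_exp_count /oddroots big_filter [in RHS]big_mkcond -prodrXl -big_split /=.
apply: eq_bigr => z _; rewrite -mup_root_seq // -exprM muln2.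
by rewrite -{1}(odd_double_half (mup z P)) exprD; case: (odd _).
Qed.

Lemma size_oddroots_decomp P (h : {poly K}) : P != 0 -> h \is monic ->
  P = lead_coef P *: (\prod_(z <- oddroots P) ('X - z%:P) * h ^+ 2) ->
  (size P).-1 = (size (oddroots P) + (size h).-1.*2)%N.
Proof.
move=> P0 hm e; rewrite {1}e size_scale ?lead_coef_eq0 //.
rewrite size_monicM ?monic_prod_XsubC ?expf_neq0 ?monic_neq0 //.
rewrite size_prod_XsubC addSn /= -subn1 -addnBA ?size_poly_gt0 ?expf_neq0 ?monic_neq0 //.
by rewrite subn1 size_exp muln2.
Qed.

Lemma size_oddroots P : P != 0 -> (size (oddroots P) <= (size P).-1)%N.
Proof.
move=> P0; have [h hm e] := oddroots_decomp P0.
by rewrite (size_oddroots_decomp P0 hm e) leq_addr.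
Qed.

Lemma size_subC P (y : K) : (1 < size P)%N -> size (P - y%:P) = size P.
Proof.
by move=> sP; rewrite size_polyDl // size_polyN (leq_ltn_trans (size_polyC_leq1 _)).
Qed.

Lemma lead_coef_subC P (y : K) : (1 < size P)%N -> lead_coef (P - y%:P) = lead_coef P.
Proof.
by move=> sP; rewrite lead_coefDl // size_polyN (leq_ltn_trans (size_polyC_leq1 _)).
Qed.

(** The number of points over [y] with odd ramification index, each counted once. *)
Definition ofib P y := size (oddroots (P - y%:P)).

(** [P - y1%:P] and [P - y2%:P] differ by a nonzero constant, which gives a Bezout relation. *)
Lemma coprime_fibers P Q1 Q2 y1 y2 : y1 != y2 ->
  Q1 %| P - y1%:P -> Q2 %| P - y2%:P -> coprimep Q1 Q2.
Proof.
move=> y12 d1 d2; apply: coprimep_dvdr d1 _; apply: coprimep_dvdl d2 _; apply/Bezout_coprimepP.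
exists (- (y1 - y2)^-1%:P, (y1 - y2)^-1%:P) => /=.
have -> : - (y1 - y2)^-1%:P * (P - y1%:P) + (y1 - y2)^-1%:P * (P - y2%:P)
   = ((y1 - y2)^-1 * (y1 - y2))%:P by rewrite polyCM polyCB; ring.
by rewrite mulVf ?subr_eq0 // eqpxx.
Qed.

(* Writing [P - y = c * s * h ^+ 2] with [s] squarefree, [h] divides [P^`()];
   this is a weak form of the Riemann-Hurwitz formula. *)
Lemma ofib_ramification P y1 y2 y3 : P^`() != 0 ->
  y1 != y2 -> y1 != y3 -> y2 != y3 ->
  ((size P).-1 + 2 <= ofib P y1 + ofib P y2 + ofib P y3)%N.
Proof.
move=> dP y12 y13 y23.
have sP : (1 < size P)%N.
  rewrite ltnNge; apply: contra dP => /size1_polyC ->; by rewrite derivC.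
have H y : exists h, [/\ h \is monic, h %| P^`(), h %| P - y%:P
    & (size P).-1 = (ofib P y + (size h).-1.*2)%N].
  have P0 := subC_neq0 y sP; have [h hm e] := oddroots_decomp P0.
  exists h; split => //.
  - have -> : P^`() = (P - y%:P)^`() by rewrite derivB derivC subr0.
    rewrite e derivZ derivM expr2 derivM -mul_polyC dvdp_mull // dvdp_add //.
      by rewrite !dvdp_mull.
    by rewrite dvdp_mull // dvdp_add ?dvdp_mulIl ?dvdp_mulIr.
  - by rewrite e -mul_polyC expr2 !dvdp_mull.
  - by rewrite -(size_subC y sP); apply: size_oddroots_decomp.
have [h1 [m1 d1 f1 s1]] := H y1; have [h2 [m2 d2 f2 s2]] := H y2.
have [h3 [m3 d3 f3 s3]] := H y3.
have dv : h1 * h2 * h3 %| P^`().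
  rewrite Gauss_dvdp ?Gauss_dvdp ?d1 ?d2 //; first exact: coprime_fibers y12 f1 f2.
  by rewrite coprimepMl (coprime_fibers y13 f1 f3) (coprime_fibers y23 f2 f3).
have P0 : P != 0 by rewrite -size_poly_gt0 ltnW.
(* With [N = deg P], the degrees of the [h] add up to at most [N - 1], while each fiber has
   [N = ofib + 2 * deg h]; summing, the three [ofib] total at least [3 * N - 2 * (N - 1)]. *)
have := leq_ltn_trans (dvdp_leq dP dv) (lt_size_deriv P0).
rewrite !size_monicM ?monicMl ?monic_neq0 //.
have g1 : (0 < size h1)%N by rewrite size_poly_gt0 monic_neq0.
have g2 : (0 < size h2)%N by rewrite size_poly_gt0 monic_neq0.
have g3 : (0 < size h3)%N by rewrite size_poly_gt0 monic_neq0.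
move: s1 s2 s3 sP g1 g2 g3; move: (ofib P y1) (ofib P y2) (ofib P y3).
move: (size P) (size h1) (size h2) (size h3); clear; lia.
Qed.

End OddRoots.

(** * Inseparable polynomials and their fibers *)

Section Fibers.
Variable K : closedFieldType.
Implicit Types (f g P : {poly K}) (x y z w : K).

Lemma closed_nth_root n y : (0 < n)%N -> exists x, x ^+ n = y.
Proof.
move=> n0; have /closed_rootP[x] : size ('X^n - y%:P) != 1.
  by rewrite size_XnsubC // eqSS -lt0n.
by rewrite rootE !hornerE subr_eq0 => /eqP; exists x.
Qed.

Lemma exists_third y1 y2 : exists y3, y1 != y3 /\ y2 != y3.
Proof.
have /closed_rootP[x] : size (('X - y1%:P) * ('X - y2%:P) + 1) != 1.
  by rewrite size_polyDl ?size_Mmonic ?polyXsubC_eq0 ?monicXsubC ?size_XsubC // size_poly1.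
rewrite rootE !hornerE => /eqP h; exists x; split.
  by apply/eqP => e; move/eqP: h; rewrite e subrr mul0r add0r oner_eq0.
by apply/eqP => e; move/eqP: h; rewrite e subrr mulr0 add0r oner_eq0.
Qed.

Section Inseparable.
Variable p : nat.
Hypotheses (pK : p \in [pchar K]) (p_odd : odd p).

Let p_pr : prime p := pcharf_prime pK.

Lemma pnat_exp_pchar e : [pchar {poly K}].-nat (p ^ e)%N.
Proof.
rewrite pnatX; apply/orP; left.
rewrite (eq_pnat _ (pcharf_eq (R := {poly K}) (p := p) _)) ?pnat_id //.
by rewrite pchar_poly.
Qed.

(** Only exponents divisible by [p] survive; their coefficients have [p]-th roots, and the Frobenius
    map is additive. *)
Lemma deriv_eq0_pth_power f : f^`() = 0 -> exists h, f = h ^+ p.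
Proof.
move=> df; rewrite -[f]coefK poly_def.
have p0 := prime_gt0 p_pr.
apply: (big_ind (fun P => exists h, P = h ^+ p)).
- by exists 0; rewrite expr0n gtn_eqF.
- move=> P1 P2 [h1 ->] [h2 ->]; exists (h1 + h2).
  by rewrite exprDn_pchar // -[p]expn1 pnat_exp_pchar.
move=> [[|i] _] /= _.
  have [c <-] := closed_nth_root f`_0 p0.
  by exists c%:P; rewrite expr0 alg_polyC polyC_exp.
have : f`_i.+1 *+ i.+1 = 0 by rewrite -coef_deriv df coef0.
rewrite -mulr_natr => /eqP; rewrite mulf_eq0 => /orP[/eqP ->|].
  by exists 0; rewrite scale0r expr0n gtn_eqF.
rewrite -(dvdn_pcharf pK) => /dvdnP[j ->].
have [c <-] := closed_nth_root f`_(j * p) p0.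
by exists (c *: 'X^j); rewrite exprZn -exprM.
Qed.

Lemma separable_power f : (1 < size f)%N ->
  exists e g, g^`() != 0 /\ f = g ^+ (p ^ e).
Proof.
have [n] := ubnP (size f); elim: n f => // n IH f hn sf.
have [df|df] := eqVneq f^`() 0; last by exists 0%N, f; rewrite expn0 expr1.
have [h fh] := deriv_eq0_pth_power df.
have sh : (size f).-1 = ((size h).-1 * p)%N by rewrite fh size_exp.
have p1 := prime_gt1 p_pr.
have [||e [g [dg hg]]] := IH h; [nia|nia|].
by exists e.+1, g; split=> //; rewrite fh hg -exprM expnSr.
Qed.

(** The fiber polynomial is [(g - y%:P) ^+ (p ^ e)], and the odd factor [p ^ e] preserves parities
    of multiplicities. *)
Lemma ofib_pow g e y : (1 < size g)%N ->
  ofib (g ^+ (p ^ e)) (y ^+ (p ^ e)) = ofib g y.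
Proof.
move=> sg; have n0 : (0 < p ^ e)%N by rewrite expn_gt0 prime_gt0.
have nodd : odd (p ^ e) by rewrite oddX p_odd orbT.
have g0 := subC_neq0 y sg.
rewrite /ofib; have -> : g ^+ (p ^ e) - (y ^+ (p ^ e))%:P = (g - y%:P) ^+ (p ^ e).
  rewrite -{1}(subrK y%:P g) exprDn_pchar ?pnat_exp_pchar //.
  by rewrite polyC_exp addrK.
apply: perm_size; apply: uniq_perm; rewrite ?oddroots_uniq // => x.
by rewrite !mem_oddroots ?expf_neq0 // mupX // oddM nodd.
Qed.

(** [D] is the degree of the separable [g] with [f = g ^+ (p ^ e)], to which [ofib_ramification]
    applies. If [D = 1], then [g] is linear. *)
Lemma fiber_bounds f : (1 < size f)%N -> exists2 D : nat,
  (forall y1 y2 y3, y1 != y2 -> y1 != y3 -> y2 != y3 ->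
     (D + 2 <= ofib f y1 + ofib f y2 + ofib f y3)%N)
  /\ (forall y, (ofib f y <= D)%N)
  & (1 < D)%N \/ exists c b e, f = c *: ('X - b%:P) ^+ (p ^ e).
Proof.
move=> sf; have [e [g [dg ->]]] := separable_power sf.
have n0 : (0 < p ^ e)%N by rewrite expn_gt0 prime_gt0.
have sg : (1 < size g)%N.
  by rewrite ltnNge; apply: contra dg => /size1_polyC ->; rewrite derivC.
have rt y : exists x, x ^+ (p ^ e) = y := closed_nth_root y n0.
exists (size g).-1; first split.
- move=> y1 y2 y3; have [x1 <-] := rt y1; have [x2 <-] := rt y2; have [x3 <-] := rt y3.
  move=> h12 h13 h23; rewrite !ofib_pow //; apply: ofib_ramification => //.
  + by apply: contraNneq h12 => ->.
  + by apply: contraNneq h13 => ->.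
  + by apply: contraNneq h23 => ->.
- move=> y; have [x <-] := rt y; rewrite ofib_pow // /ofib.
  by rewrite -(size_subC x sg) size_oddroots ?subC_neq0.
have [h|h] := ltnP 2 (size g); [left; lia|right].
have := root_seqE g; have : size (root_seq g) = 1%N.
  have := congr1 (fun P : {poly K} => size P) (root_seqE g).
  have g0 : g != 0 by rewrite -size_poly_gt0 ltnW.
  rewrite size_scale ?lead_coef_eq0 // size_prod_XsubC; lia.
case: (root_seq g) => [|b [|//]] // _ ->; rewrite big_seq1.
by exists (lead_coef g ^+ (p ^ e)), b, e; rewrite exprZn.
Qed.

End Inseparable.
End Fibers.

(** * Odd preimages of zero under iteration *)

Section Dynamics.
Variable K : closedFieldType.
Implicit Types (x y z w : K).
Variables (f : {poly K}) (D : nat).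
Hypotheses (sf : (1 < size f)%N) (D_gt1 : (1 < D)%N).
Hypothesis fib3 : forall y1 y2 y3, y1 != y2 -> y1 != y3 -> y2 != y3 ->
     (D + 2 <= ofib f y1 + ofib f y2 + ofib f y3)%N.
Hypothesis fib_le : forall y, (ofib f y <= D)%N.

Definition oddfib y x : bool := odd (mup x (f - y%:P)).

(* [x] first reaches [0] after exactly [n] steps, through points at which [f]
   is ramified to odd order. *)
Fixpoint primitive_odd (n : nat) x : Prop :=
  if n is n'.+1 then [/\ primitive_odd n' f.[x], oddfib f.[x] x & x != 0]
  else x = 0.

Lemma oddfib_horner y x : oddfib y x -> f.[x] = y.
Proof. by move/odd_mup_root; rewrite rootE !hornerE subr_eq0 => /eqP. Qed.

Lemma mem_ofib y x : (x \in oddroots (f - y%:P)) = oddfib y x.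
Proof. by rewrite mem_oddroots ?subC_neq0. Qed.

Lemma ofib_pair y1 y2 : y1 != y2 -> (2 <= ofib f y1 + ofib f y2)%N.
Proof.
move=> y12; have [y3 [y13 y23]] := exists_third y1 y2.
by have := fib3 y12 y13 y23; have := fib_le y3; lia.
Qed.

Lemma ofib_pick y z : (1 < ofib f y)%N -> exists2 x, oddfib y x & x != z.
Proof.
rewrite /ofib => h; case: (altP (@allP _ (pred1 z) (oddroots (f - y%:P)))) => [H|].
  have := uniq_leq_size (oddroots_uniq (f - y%:P)) (s2 := [:: z]).
  rewrite leqNgt h => /(_ _)/negP; case => // x /H /eqP ->.
  by rewrite mem_head.
by case/allPn => x; rewrite mem_ofib; exists x.
Qed.

(** Fibers over distinct values are disjoint and together have at least two points of odd index, so
    inside a set of at most two points they fill it. *)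
Lemma ofib_pair_subset y1 y2 (s : seq K) : y1 != y2 ->
  (forall x, oddfib y1 x -> x \in s) -> (forall x, oddfib y2 x -> x \in s) ->
  (ofib f y1 + ofib f y2 <= size s)%N /\
  ((size s <= 2)%N -> forall x, x \in s -> oddfib y1 x || oddfib y2 x).
Proof.
move=> y12 h1 h2; pose L := oddroots (f - y1%:P) ++ oddroots (f - y2%:P).
have uL : uniq L.
  rewrite cat_uniq !oddroots_uniq andbT /=; apply/hasPn => x.
  rewrite !mem_ofib => /oddfib_horner e2; apply/negP => /oddfib_horner e1.
  by rewrite -e1 -e2 eqxx in y12.
have sL : {subset L <= s}.
  by move=> x; rewrite mem_cat !mem_ofib => /orP[/h1|/h2].
have szL : (size L = ofib f y1 + ofib f y2)%N by rewrite size_cat.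
split; first by rewrite -szL uniq_leq_size.
move=> ss x; have [|_ <-] := uniq_min_size uL sL.
  by rewrite szL (leq_trans ss) // ofib_pair.
by rewrite mem_cat !mem_ofib.
Qed.

(** Induction on the step: if a primitive point [y] has none above it, the odd points over it lie in
    [[:: 0]]. Such tiny fibers are so rare that the dynamics near [0] is forced into one of the
    first two alternatives. *)
Theorem primitive_odd_nonempty :
  [\/ forall x, oddfib 0 x -> x = 0,
      exists y, [/\ y != 0, oddfib 0 y, (forall x, oddfib 0 x -> x = 0 \/ x = y)
        & (oddfib 0 0 /\ forall x, ~ oddfib y x) \/
          (~ oddfib 0 0 /\ forall x, oddfib y x <-> x = 0)]
    | forall n, exists x, primitive_odd n x].
Proof.
have [h0|h0] := classic (forall x, oddfib 0 x -> x = 0); first by constructor 1.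
have [h1|h1] := classic (exists y, [/\ y != 0, oddfib 0 y,
   (forall x, oddfib 0 x -> x = 0 \/ x = y)
        & (oddfib 0 0 /\ forall x, ~ oddfib y x) \/
          (~ oddfib 0 0 /\ forall x, oddfib y x <-> x = 0)]); first by constructor 2.
constructor 3; elim=> [|n [y hy]]; first by exists 0.
apply: NNPP => none.
have leaf y' : primitive_odd n y' -> forall x, oddfib y' x -> x \in [:: 0].
  move=> hy' x hx; rewrite inE; apply/negP => /negP x0; apply: none; exists x.
  by split; rewrite ?(oddfib_horner hx).
case: n => [|n] in hy leaf none *.
  by apply: h0 => x; move: (leaf _ hy x); rewrite hy inE => h /h /eqP.
(* Another such point would give two fibers sharing the single possible point [0]. *)
have uniq_prim x : primitive_odd n.+1 x -> x = y.
  move=> hx; apply/eqP/negPn/negP => xy.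
  by have [] := ofib_pair_subset xy (leaf x hx) (leaf y hy); have := ofib_pair xy; rewrite /=; lia.
have [hz yE y0] := hy; set z := f.[y] in hz yE.
have zy : z != y.
  apply/eqP => e; move: (leaf y hy y); rewrite -{1}e yE => /(_ isT).
  by rewrite inE (negbTE y0).
(* A nonzero odd point over [z] is primitive at the same step as [y], hence equals [y]. *)
have fz x : oddfib z x -> x \in [:: 0; y].
  move=> hx; rewrite !inE; case: eqP => //= /eqP x0.
  by apply/eqP/uniq_prim; split; rewrite ?(oddfib_horner hx).
have fy x : oddfib y x -> x \in [:: 0; y].
  by move/(leaf y hy); rewrite !inE => ->.
have [le2 /(_ isT) cover] := ofib_pair_subset zy fz fy; rewrite /= in le2.
(* For [z = 0] the second alternative arises, its two cases according to whether [0] lies over [0]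
   or over [y]. *)
have [z0|z0] := eqVneq z 0.
  rewrite z0 in fz cover yE zy; apply: h1; exists y; split => //.
    by move=> x /fz; rewrite !inE => /orP[/eqP ->|/eqP ->]; [left|right].
  have := cover 0; rewrite mem_head => /(_ isT) /orP[h|h]; [left|right].
    split=> // x hx; have := leaf y hy x hx; rewrite inE => /eqP x0.
    move: hx; rewrite x0 => /oddfib_horner; rewrite (oddfib_horner h) => e.
    by rewrite e eqxx in zy.
  split; first by move/oddfib_horner => e; rewrite -e (oddfib_horner h) eqxx in zy.
  move=> x; split => [/(leaf y hy)|-> //].
  by rewrite inE => /eqP.
case: n => [|n] in hy leaf none uniq_prim hz *; first by rewrite /= in hz; rewrite hz eqxx in z0.
have [hw zE _] := hz; set w := f.[z] in hw zE.
have zw : z != w.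
  apply/eqP => e; move: (fz z); rewrite {1}e zE => /(_ isT).
  by rewrite !inE (negbTE z0) (negbTE zy).
have yw : y != w.
  apply/eqP => e; move: (leaf y hy z); rewrite {1}e zE => /(_ isT).
  by rewrite inE (negbTE z0).
(* The fibers over [z] and [y] use at most two odd points, so any third value has at least [D > 1].
   This is applied to [w], then to a new point [x] over [w], yielding a primitive point over [x]; by
   uniqueness it is [y], but [y] lies over [z]. *)
have big w' : z != w' -> y != w' -> (1 < ofib f w')%N.
  by move=> h h'; have := fib3 zy h h'; lia.
have [x xw xz] := ofib_pick z (big w zw yw).
have f0 : f.[0] = z \/ f.[0] = y.
  by have := cover 0; rewrite mem_head => /(_ isT) /orP[] /oddfib_horner; [left|right].
have fx := oddfib_horner xw.
have x0 : x != 0.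
  by apply/eqP => e; case: f0; rewrite -e fx => e'; rewrite e' eqxx in zw yw.
have xy : x != y.
  by apply/eqP => e; move: fx; rewrite e -/z => e'; rewrite e' eqxx in zw.
have hx : primitive_odd n.+1 x by split; rewrite ?fx.
have [zx yx] : z != x /\ y != x by rewrite eq_sym xz eq_sym xy.
have [v vx v0] := ofib_pick 0 (big x zx yx).
have vy : v = y by apply: uniq_prim; split; rewrite ?(oddfib_horner vx).
by move: (oddfib_horner vx) zx; rewrite vy -/z => ->; rewrite eqxx.
Qed.

End Dynamics.

(** * Products of iterates are not squares *)

Lemma nonsquare_map (F : fieldType) (K : fieldType) (iota : {rmorphism F -> K})
  (f : {poly F}) : nonsquare (map_poly iota f) -> nonsquare f.
Proof.
move=> fns c r s e c0; apply/eqP; rewrite -(map_poly_eq0 iota); apply/eqP.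
apply: (fns (iota c) _ (map_poly iota s)); last by rewrite fmorph_eq0.
by rewrite -rmorphXn -rmorphM e /= map_polyZ rmorphXn.
Qed.

(** Same body as [poly_iter], but over any ring, since iterates are also taken over the closed
    field. *)
Definition comp_iter (R : nzRingType) (f : {poly R}) (n : nat) : {poly R} :=
  iter n (fun g => f \Po g) 'X.

Section CompIter.
Variable R : comNzRingType.
Implicit Types f : {poly R}.

Lemma comp_iterSr f n : comp_iter f n.+1 = comp_iter f n \Po f.
Proof.
elim: n => [|n IH]; first by rewrite /comp_iter /= comp_polyX comp_polyXr.
rewrite -[LHS]/(f \Po comp_iter f n.+1) -[in RHS]/(f \Po comp_iter f n) -comp_polyA.
by rewrite IH.
Qed.

Lemma comp_iterD f m n : comp_iter f (m + n) = comp_iter f m \Po comp_iter f n.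
Proof.
elim: m => [|m IH]; first by rewrite /comp_iter /= comp_polyX.
rewrite addSn -[LHS]/(f \Po comp_iter f (m + n)) -[comp_iter f m.+1]/(f \Po comp_iter f m).
by rewrite IH comp_polyA.
Qed.
End CompIter.

Lemma size_comp_iter (R : idomainType) (f : {poly R}) d n : size f = d.+1 -> (0 < d)%N ->
  size (comp_iter f n) = (d ^ n).+1.
Proof.
move=> hf d0; elim: n => [|n IH]; first by rewrite /comp_iter /= size_polyX.
rewrite /comp_iter iterS -/(comp_iter f n).
have := size_comp_poly f (comp_iter f n); rewrite hf IH /= -expnS => h.
rewrite -h prednK // lt0n; apply/eqP => s0; move: h; rewrite s0 /=.
by case: (d ^ _)%N (expn_gt0 d n.+1); rewrite d0.
Qed.

Section PrimitiveProducts.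
Variables (K : closedFieldType) (f : {poly K}) (d : nat).
Hypotheses (szf : size f = d.+1) (d_gt0 : (0 < d)%N).

Lemma comp_iter_neq0 n : comp_iter f n != 0.
Proof. by rewrite -size_poly_gt0 (size_comp_iter _ szf). Qed.

Lemma primitive_odd_mup n x : primitive_odd f n x ->
  odd (mup x (comp_iter f n)) /\
  forall i, (i < n)%N -> ~~ root (comp_iter f i) x.
Proof.
elim: n x => [|n IH] x.
  by move=> /= ->; split => //; have := @mup_XsubCX K 1 0 0; rewrite eqxx expr1 subr0 => ->.
case=> /IH[h1 h2] h3 x0; split.
  by rewrite comp_iterSr mup_comp ?comp_iter_neq0 ?szf // oddM h1.
case=> [|i] hi; first by rewrite /comp_iter /= rootX.
by rewrite comp_iterSr /root horner_comp; exact: h2.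
Qed.

(** For the largest index [n] in [S], a primitive point is a root of odd multiplicity of the [n]-th
    iterate and not a root of the others, while squares have even multiplicities. *)
Lemma nonsquare_prod_comp_iter r (S : {set 'I_r}) :
  (forall n, exists x, primitive_odd f n x) -> S != finset.set0 ->
  nonsquare (\prod_(i in S) comp_iter f i).
Proof.
move=> H /finset.set0Pn[i0 i0S] c u v e c0; apply/eqP; apply: contraTT isT => u0.
have prod0 : \prod_(i in S) comp_iter f i != 0.
  by apply/prodf_neq0 => i _; apply: comp_iter_neq0.
have [n nS maxn] : exists2 n, n \in S & forall i, i \in S -> (i <= n)%N.
  by case: (arg_maxnP (fun i : 'I_r => (i : nat)) i0S) => n; exists n.
have [x /primitive_odd_mup[h1 h2]] := H n.
have v0 : v != 0.
  apply: contraNneq (mulf_neq0 (expf_neq0 2 u0) prod0) => v0.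
  by rewrite e v0 expr0n scaler0.
move/(congr1 (fun P => odd (mup x P))): e; rewrite mupM ?expf_neq0 // mupZ // !mupX //.
rewrite oddD !oddM /= (bigD1 n) //= mupMl ?h1 //.
rewrite /root horner_prod; apply/prodf_neq0 => i /andP[iS ni].
by apply: h2; rewrite ltn_neqAle maxn // andbT; apply: contra ni => /eqP /val_inj ->.
Qed.
End PrimitiveProducts.

(** * Recurrences and the exceptional forms *)

Section ChebyshevODE.
Variable K : fieldType.
Hypothesis two0 : (2 : K) != 0.
Implicit Types (h k : {poly K}).

Lemma coef_deriv_mul h j : (h^`())`_j = h`_j.+1 * (j%:R + 1).
Proof. by rewrite coef_deriv natr1 mulr_natr. Qed.

Lemma coef_Xderiv h j : ('X * h^`())`_j = h`_j * j%:R.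
Proof.
rewrite coefXM; case: j => [|j]; first by rewrite mulr0.
by rewrite coef_deriv mulr_natr.
Qed.

Lemma coef_XXderiv2 h j :
  ('X * ('X * h^`()^`()))`_j = h`_j * (j%:R ^+ 2 - j%:R).
Proof.
have -> : 'X * ('X * h^`()^`()) = 'X * ('X * h^`())^`() - 'X * h^`().
  by rewrite derivM derivX; ring.
by rewrite coefB !coef_Xderiv; ring.
Qed.

Lemma dvdp_size_scale h (P : {poly K}) n : h \is monic -> size h = n.+1 ->
  (size P <= n.+1)%N -> h %| P -> P = P`_n *: h.
Proof.
move=> hm sh sP /dvdpP[Q PQ].
have hn : h`_n = 1 by move/monicP: hm; rewrite lead_coefE sh.
have [Q0|Q0] := eqVneq Q 0; first by rewrite PQ Q0 mul0r coef0 scale0r.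
have : size Q = 1%N.
  move: sP; rewrite PQ size_Mmonic // sh; have := Q0; rewrite -size_poly_gt0.
  by case: (size Q) => // m _; rewrite addSn addnS /=; lia.
by move/eqP/size_poly1P => [c c0 Qc]; rewrite PQ Qc mul_polyC coefZ hn mulr1.
Qed.

(** Differentiating gives [2 h h' = k W]. As [h] and [k] are coprime, [h] divides [W], and degrees
    give [W = 2 n h], so [h' = n k]. Eliminating [k] leaves
    [2 X (X - B) h'' + (2 X - B) h' = 2 n^2 h], which is compared coefficientwise. *)
Lemma recurrence_d (h k : {poly K}) (A B : K) (n : nat) :
  A != 0 -> B != 0 -> h \is monic -> k \is monic -> size h = n.+1 -> size k = n ->
  A *: h ^+ 2 + B%:P = A *: ('X * ('X - B%:P) * k ^+ 2) ->
  forall i, (1 <= i <= n)%N ->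
  i%:R * (2 * i%:R - 1) * B * h`_i
   = - 2 * (n%:R + i%:R - 1) * (n%:R - i%:R + 1) * h`_i.-1.
Proof.
move=> A0 B0 hm km sh sk e.
have h0 := monic_neq0 hm; have k0 := monic_neq0 km.
pose W := ('X *+ 2 - B%:P) * k + ('X * ('X - B%:P) * k^`()) *+ 2.
have e1 : (h * h^`()) *+ 2 = k * W.
  move/(congr1 (@deriv K)): e; rewrite derivD derivC addr0 !derivZ.
  move/(scalerI A0); rewrite !expr2 !derivM derivB derivX derivC subr0 => e.
  by rewrite mulr2n {1}mulrC e /W; ring.
have cop : coprimep h k.
  apply/Bezout_coprimepP.
  exists (- (B^-1 * A) *: h, (B^-1 * A) *: ('X * ('X - B%:P) * k)) => /=.
  have -> : - (B^-1 * A) *: h * h + (B^-1 * A) *: ('X * ('X - B%:P) * k) * k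
     = B^-1 *: (A *: ('X * ('X - B%:P) * k ^+ 2) - A *: h ^+ 2).
    by rewrite -!mul_polyC polyCN !polyCM; ring.
  by rewrite -e addrAC subrr add0r -mul_polyC -polyCM mulVf // eqpxx.
have hW : h %| W.
  by rewrite -(Gauss_dvdpr _ cop) -e1 -mulrnAr dvdp_mulIl.
have n0 : (0 < n)%N by rewrite -sk size_poly_gt0.
have coefW i : W`_i.+1 = k`_i * 2 * (1 + i%:R) - B * k`_i.+1 * (1 + 2 * (i%:R + 1)).
  have -> : W = ('X * k) *+ 2 - B *: k + ('X * ('X * k^`())) *+ 2 - B *: ('X * k^`()) *+ 2.
    by rewrite /W -!mul_polyC; ring.
  rewrite !(coefB, coefD, coefN, coefMn, coefZ) coef_Xderiv.
  rewrite [('X * ('X * _))`_ _]coefXM coef_Xderiv coefXM /= -natr1; ring.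
have sW : (size W <= n.+1)%N.
  apply/leq_sizeP => -[|i] // hi; rewrite coefW !nth_default ?sk //; last by lia.
  by rewrite !mul0r mulr0 mul0r subrr.
have Wn : W`_n = n%:R *+ 2.
  have kn : k`_n.-1 = 1 by move/monicP: km; rewrite lead_coefE sk.
  have kn' : k`_n = 0 by rewrite nth_default // sk.
  rewrite -[in LHS](prednK n0) coefW prednK // kn kn' -[in RHS](prednK n0) -natr1; ring.
have {}hW := dvdp_size_scale hm sh sW hW.
have dh : h^`() = n%:R *: k.
  have two0' : (2%:P : {poly K}) != 0 by rewrite polyC_eq0.
  apply: (mulfI two0'); apply: (mulfI h0).
  transitivity ((h * h^`()) *+ 2); first by rewrite polyCMn polyC1; ring.
  by rewrite e1 hW Wn -!mul_polyC !polyCMn polyC1; ring.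
have ode : ('X * h^`()) *+ 2 - B *: h^`() + ('X * ('X * h^`()^`())) *+ 2
     - B *: ('X * h^`()^`()) *+ 2 = (n%:R ^+ 2 *+ 2) *: h.
  transitivity (n%:R *: W); last by rewrite hW Wn scalerA; congr (_ *: _); ring.
  by rewrite /W dh derivZ -!mul_polyC; ring.
case=> // j hj; have /(congr1 (fun P : {poly K} => P`_j)) := ode.
rewrite !(coefB, coefD, coefN, coefMn, coefZ) !coef_Xderiv coef_XXderiv2 !coef_deriv_mul /= => E.
rewrite -natr1; move: E; move: h`_j h`_j.+1 => u v E.
by apply: (@addIr _ (n%:R ^+ 2 *+ 2 * u)); rewrite -[in LHS]E; ring.
Qed.

(** Differentiating gives [g V = k U] with [g], [k] coprime, so [V = (2 n + 1) k] and
    [U = (2 n + 1) g] by degrees. Eliminating [k] yields [V + 2 X V' = (2 n + 1)^2 g], an equation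
    of second order for [g]. *)
Lemma recurrence_e (g k : {poly K}) (A B : K) (n : nat) :
  A != 0 -> B != 0 -> g \is monic -> k \is monic -> size g = n.+1 -> size k = n.+1 ->
  A *: (('X - B%:P) * g ^+ 2) - B%:P = A *: ('X * k ^+ 2) ->
  forall i, (1 <= i <= n)%N ->
  i%:R * (2 * i%:R - 1) * B * g`_i
   = - 2 * (n%:R - i%:R + 1) * (n%:R + i%:R) * g`_i.-1.
Proof.
move=> A0 B0 gm km sg sk e.
have g0 := monic_neq0 gm; have k0 := monic_neq0 km.
pose V := g + (('X - B%:P) * g^`()) *+ 2; pose U := k + ('X * k^`()) *+ 2.
have e1 : g * V = k * U.
  move/(congr1 (@deriv K)): e; rewrite derivB derivC subr0 !derivZ.
  move/(scalerI A0); rewrite !expr2 !derivM derivB derivX derivC subr0 => e.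
  transitivity (1 * (g * g) + ('X - B%:P) * (g^`() * g + g * g^`())); first by rewrite /V; ring.
  by rewrite e /U; ring.
have cop : coprimep k g.
  apply/Bezout_coprimepP.
  exists (- (B^-1 * A) *: ('X * k), (B^-1 * A) *: (('X - B%:P) * g)) => /=.
  have -> : - (B^-1 * A) *: ('X * k) * k + (B^-1 * A) *: (('X - B%:P) * g) * g
     = B^-1 *: (A *: (('X - B%:P) * g ^+ 2) - A *: ('X * k ^+ 2)).
    by rewrite -!mul_polyC polyCN !polyCM; ring.
  by rewrite -e opprB addrC subrK -mul_polyC -polyCM mulVf // eqpxx.
have kV : k %| V by rewrite -(Gauss_dvdpr _ cop) e1 dvdp_mulIl.
have coefV i : V`_i = g`_i * (1 + 2 * i%:R) - B * (g`_i.+1 * (i%:R + 1)) * 2.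
  have -> : V = g + ('X * g^`()) *+ 2 - B *: (g^`() *+ 2) by rewrite /V -mul_polyC; ring.
  rewrite !(coefB, coefD, coefN, coefMn, coefZ) coef_Xderiv coef_deriv_mul; ring.
have sV : (size V <= n.+1)%N.
  apply/leq_sizeP => i hi; rewrite coefV !nth_default ?sg //; last by lia.
  by rewrite !mul0r mulr0 mul0r subrr.
have Vn : V`_n = 1 + 2 * n%:R.
  have gn : g`_n = 1 by move/monicP: gm; rewrite lead_coefE sg.
  by rewrite coefV gn [g`_n.+1]nth_default ?sg //; ring.
have {}kV := dvdp_size_scale km sk sV kV.
have gU : V`_n *: g = U.
  by apply: (mulfI k0); rewrite -e1 [in RHS]kV -!mul_polyC; ring.
have ode : V + ('X * V^`()) *+ 2 = V`_n ^+ 2 *: g.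
  by rewrite expr2 -scalerA gU {1 2}kV derivZ /U -!mul_polyC; ring.
case=> // j hj; have /(congr1 (fun P : {poly K} => P`_j)) := ode.
rewrite coefD coefMn coefZ coef_Xderiv Vn coefV => E.
apply: (mulfI two0); rewrite -natr1; move: E => /=; move: g`_j g`_j.+1 => u v E.
by apply: (@addIr _ ((1 + 2 * n%:R) ^+ 2 * u)); rewrite -[in LHS]E; ring.
Qed.
End ChebyshevODE.

(** * Descent of the exceptional forms to the finite field *)

Lemma pchar_frobenius (K : fieldType) p a : p \in [pchar K] ->
  exists sigma : {rmorphism K -> K}, forall x, sigma x = x ^+ (p ^ a).
Proof.
move=> pK; elim: a => [|a [s hs]]; first by exists idfun => x; rewrite expn0 expr1.
by exists (pFrobenius_aut pK \o s) => x /=; rewrite hs pFrobenius_autE expnSr exprM.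
Qed.

Lemma mup_map (K L : fieldType) (s : {rmorphism K -> L}) (P : {poly K}) x :
  P != 0 -> mup (s x) (map_poly s P) = mup x P.
Proof.
move=> P0; have [m [Q]] := multiplicity_XsubC P x; rewrite P0 /= => Qx ->.
rewrite rmorphM rmorphXn /= map_polyXsubC.
by rewrite !mupMr ?mup_XsubCX ?eqxx // -?map_poly_root ?fmorph_root.
Qed.

Section Descent.
Variables (F : finFieldType) (K : closedFieldType) (iota : {rmorphism F -> K}).
Variables (p a : nat).
Hypotheses (p_pr : prime p) (p_odd : odd p) (cardF : #|F| = (p ^ a)%N).

Lemma pchar_closure : p \in [pchar K].
Proof. by rewrite (fmorph_pchar iota); apply: card_finPcharP cardF p_pr. Qed.

Lemma two_neq0_closure : (2 : K) != 0.
Proof.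
rewrite -(dvdn_pcharf pchar_closure); apply/negP => p2.
have /eqP p_eq2 : p == 2 by rewrite -dvdn_prime2.
by move: p_odd; rewrite p_eq2.
Qed.

(** Over [F] the polynomial ['X^q - 'X] splits with roots the elements of [F], which leaves no other
    root in [K]. *)
Lemma fixed_in_range (x : K) : x ^+ #|F| = x -> exists c, x = iota c.
Proof.
move=> xq; have : root (map_poly iota ('X^#|F| - 'X)) x.
  by rewrite rmorphB /= map_polyXn map_polyX rootE !hornerE xq subrr.
rewrite finField_genPoly rmorph_prod /= /root horner_prod => /eqP/eqP/prodf_eq0[c _].
by rewrite map_polyXsubC hornerXsubC subr_eq0 => /eqP ->; exists c.
Qed.

Lemma poly_fixed_in_range (h : {poly K}) : (forall i, h`_i ^+ #|F| = h`_i) ->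
  exists u, h = map_poly iota u.
Proof.
move=> H; exists (\poly_(i < size h) odflt 0 [pick c | h`_i == iota c]).
apply/polyP => i; rewrite coef_map coef_poly; case: ltnP => hi; last first.
  by rewrite nth_default //= rmorph0.
case: pickP => [c /eqP // | no]; have [c hc] := fixed_in_range (H i).
by have := no c; rewrite hc eqxx.
Qed.

(** Frobenius fixes [h ^+ 2], hence sends [h] to [h] or [- h]; the latter is excluded because [h] is
    monic and [2 != 0]. *)
Lemma sqrt_in_range (h : {poly K}) (u : {poly F}) : h \is monic ->
  h ^+ 2 = map_poly iota u -> exists g, h = map_poly iota g.
Proof.
move=> hm hu; have [s hs] := pchar_frobenius a pchar_closure.
apply: poly_fixed_in_range => i; rewrite cardF -hs -coef_map.
suff -> : map_poly s h = h by [].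
have fixu : map_poly s (map_poly iota u) = map_poly iota u.
  by apply/polyP => j; rewrite !coef_map /= hs -cardF -rmorphXn /= expf_card.
have : (map_poly s h) ^+ 2 == h ^+ 2 by rewrite -rmorphXn /= hu fixu.
rewrite eqf_sqr => /orP[/eqP|/eqP e]; first exact.
have := congr1 (@lead_coef K) e; rewrite lead_coef_map lead_coefN (monicP hm) rmorph1.
by move/eqP; rewrite -subr_eq0 opprK (negbTE two_neq0_closure).
Qed.

Lemma oddroots_sub1 (P : {poly K}) (y : K) : P != 0 ->
  (forall x, odd (mup x P) -> x = y) -> oddroots P = [::] \/ oddroots P = [:: y].
Proof.
move=> P0 H; have : {subset oddroots P <= [:: y]}.
  by move=> x; rewrite mem_oddroots // inE => /H ->.
have := oddroots_uniq P; case: (oddroots P) => [|x [|x' s]]; [by left| |].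
  by move=> _ /(_ x); rewrite !inE eqxx => /(_ isT) /eqP ->; right.
move=> /= /andP[xs _] H'; move: (H' x) (H' x'); rewrite !inE !eqxx orbT.
by move=> /(_ isT) /eqP e /(_ isT) /eqP e'; rewrite e e' mem_head in xs.
Qed.

Lemma perm_oddroots (P : {poly K}) (s : seq K) : P != 0 -> uniq s ->
  (forall x, odd (mup x P) <-> x \in s) -> perm_eq (oddroots P) s.
Proof.
move=> P0 us H; apply: uniq_perm (oddroots_uniq P) us _ => x.
by rewrite mem_oddroots //; apply/idP/idP => /H.
Qed.

Variables (f : {poly F}) (d : nat).
Hypotheses (d_ge2 : (2 <= d)%N) (szf : size f = d.+1).
Let fK := map_poly iota f.

Let szfK : size fK = d.+1. Proof. by rewrite size_map_poly. Qed.
Let fK_gt1 : (1 < size fK)%N. Proof. by rewrite szfK ltnS ltnW. Qed.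
Let f_neq0 : f != 0. Proof. by rewrite -size_poly_gt0 szf. Qed.
Let fK_neq0 : fK != 0. Proof. by rewrite map_poly_eq0. Qed.
Let leadK : lead_coef fK = iota (lead_coef f). Proof. exact: lead_coef_map. Qed.

Lemma map_frobenius_fixed (s : {rmorphism K -> K}) :
  (forall x, s x = x ^+ (p ^ a)) -> map_poly s fK = fK.
Proof.
move=> hs; apply/polyP => j.
by rewrite !coef_map /= hs -cardF -rmorphXn /= expf_card.
Qed.

(** Frobenius permutes the roots of [fK], so it fixes the only one, [b]; and [d >= 2] excludes
    [e = 0]. *)
Lemma form_a_of_single_root c b e : fK = c *: ('X - b%:P) ^+ (p ^ e) -> form_a f p.
Proof.
move=> fE; have [s hs] := pchar_frobenius a pchar_closure.
have n0 : (0 < p ^ e)%N by rewrite expn_gt0 prime_gt0.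
have cE : c = iota (lead_coef f).
  by rewrite -leadK fE lead_coefZ lead_coef_exp lead_coefXsubC expr1n mulr1.
have c0 : c != 0 by rewrite cE fmorph_eq0 lead_coef_eq0.
have : root fK (s b).
  rewrite -(map_frobenius_fixed hs) fmorph_root fE rootE !hornerE subrr.
  by rewrite expr0n gtn_eqF ?mulr0.
rewrite fE rootE !hornerE mulf_eq0 (negbTE c0) expf_eq0 n0 /= subr_eq0 hs -cardF.
move/eqP/fixed_in_range => [B bB].
exists (lead_coef f), B, e; split.
  rewrite lt0n; apply/eqP => e0; move: szfK; rewrite fE size_scale // e0 expn0 expr1.
  by rewrite size_XsubC => -[d1]; move: d_ge2; rewrite -d1.
apply: (map_poly_inj iota); rewrite -/fK fE bB cE mul_polyC map_polyZ rmorphXn /=.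
by rewrite map_polyXsubC.
Qed.

Lemma form_b_c_of_fiber : (forall x, oddfib fK 0 x -> x = 0) -> form_b f \/ form_c f.
Proof.
rewrite /oddfib polyC0 subr0 => H.
have [h hm e] := oddroots_decomp fK_neq0.
have A0 : lead_coef f != 0 by rewrite lead_coef_eq0.
case: (oddroots_sub1 fK_neq0 H) => s; move: e; rewrite s leadK.
  rewrite big_nil mul1r => e; left.
  have [|g gE] := @sqrt_in_range h ((lead_coef f)^-1 *: f) hm.
    by rewrite map_polyZ -/fK e scalerA fmorphV mulVf ?scale1r ?fmorph_eq0.
  exists (lead_coef f), g; apply: (map_poly_inj iota).
  by rewrite -/fK e gE mul_polyC map_polyZ rmorphXn.
rewrite big_seq1 polyC0 subr0 => e; right.
(* The factor ['X] is removed over [F] first, so that [sqrt_in_range] meets an exact square. *)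
have /factor_theorem[f1 f1E] : root f 0.
  by rewrite -(fmorph_root iota) -/fK e rmorph0 rootE !hornerE /= ?(mul0r, mulr0).
rewrite polyC0 subr0 in f1E.
have f1K : map_poly iota f1 = iota (lead_coef f) *: h ^+ 2.
  have X0 : ('X : {poly K}) != 0 by rewrite polyX_eq0.
  apply: (mulIf X0); rewrite -[LHS]/(_ * 'X).
  transitivity fK; first by rewrite /fK f1E rmorphM /= map_polyX.
  by rewrite e -scalerAl mulrC.
have [|g gE] := @sqrt_in_range h ((lead_coef f)^-1 *: f1) hm.
  by rewrite map_polyZ f1K scalerA fmorphV mulVf ?scale1r ?fmorph_eq0.
exists (lead_coef f), g; apply: (map_poly_inj iota).
by rewrite -/fK e gE -mulrA mul_polyC map_polyZ rmorphM /= map_polyX rmorphXn.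
Qed.

(** Frobenius preserves multiplicities of roots of [fK] and fixes [0], so it cannot move [y]. *)
Lemma fixed_of_unique_oddroot y : oddfib fK 0 y -> y != 0 ->
  (forall x, oddfib fK 0 x -> x = 0 \/ x = y) -> exists B, y = iota B.
Proof.
rewrite /oddfib polyC0 subr0 => yE y0 H.
have [s hs] := pchar_frobenius a pchar_closure.
have sE : odd (mup (s y) fK) by rewrite -(map_frobenius_fixed hs) mup_map.
have sy : s y = y.
  by case: (H _ sE) => [/eqP|//]; rewrite fmorph_eq0 (negbTE y0).
by apply: fixed_in_range; rewrite cardF -hs.
Qed.

(** Here [f = A X (X - y) k^2] and [f - y = A h^2]; evaluation at [0] gives the constant term of
    [h]. *)
Lemma form_d_of_fiber y : oddfib fK 0 y -> y != 0 ->
  (forall x, oddfib fK 0 x -> x = 0 \/ x = y) ->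
  oddfib fK 0 0 -> (forall x, ~ oddfib fK y x) -> form_d f iota.
Proof.
move=> yE y0 H zE none; have [B yB] := fixed_of_unique_oddroot yE y0 H.
have P0 := subC_neq0 y fK_gt1.
have [k km ek] := oddroots_decomp fK_neq0; have [h hm eh] := oddroots_decomp P0.
have sk := size_oddroots_decomp fK_neq0 km ek.
have sh := size_oddroots_decomp P0 hm eh.
have pk : perm_eq (oddroots fK) [:: 0; y].
  apply: (perm_oddroots fK_neq0); first by rewrite /= inE eq_sym y0.
  move=> x; have -> : odd (mup x fK) = oddfib fK 0 x by rewrite /oddfib polyC0 subr0.
  rewrite !inE; split=> [/H[->|->]|/orP[/eqP ->|/eqP ->]]; rewrite ?eqxx ?orbT //.
have ph : oddroots (fK - y%:P) = [::].
  case E : (oddroots _) => [|x s] //; case: (none x).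
  by rewrite /oddfib -mem_oddroots // E mem_head.
rewrite (perm_size pk) szfK /= in sk; rewrite ph (size_subC y fK_gt1) szfK /= in sh.
rewrite (perm_big _ pk) big_cons big_seq1 /= polyC0 subr0 leadK in ek.
rewrite ph big_nil mul1r (lead_coef_subC y fK_gt1) leadK in eh.
have h0 : (0 < size h)%N by rewrite size_poly_gt0 monic_neq0.
have k0 : (0 < size k)%N by rewrite size_poly_gt0 monic_neq0.
have A0 : iota (lead_coef f) != 0 by rewrite fmorph_eq0 lead_coef_eq0.
pose n := (size h).-1.
have shn : size h = n.+1 by rewrite /n prednK.
have skn : size k = n.
  by move: sk sh k0; rewrite /n; move: (size h).-1 (size k); clear; lia.
have e2 : iota (lead_coef f) *: h ^+ 2 + y%:P
    = iota (lead_coef f) *: ('X * ('X - y%:P) * k ^+ 2).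
  by rewrite -ek -eh subrK.
exists (lead_coef f), B, n, (fun i => h`_i); split.
- by rewrite -shn coefK mul_polyC -yB -eh subrK.
- rewrite -horner_coef0 -yB; have := congr1 (fun P : {poly K} => P.[0]) e2.
  rewrite !hornerE /= ?(mul0r, mulr0) => /eqP; rewrite addr_eq0 => /eqP e.
  by apply: (mulfI A0); rewrite expr2 mulrA e mulrN mulrCA divff // mulr1.
- move=> i hi; rewrite -yB.
  have rec := recurrence_d two_neq0_closure A0 y0 hm km shn skn e2 hi.
  exact rec.
Qed.

(** Here [f = A (X - y) g^2] and [f - y = A X k^2]; evaluation at [0] gives the constant term of
    [g]. *)
Lemma form_e_of_fiber y : oddfib fK 0 y -> y != 0 ->
  (forall x, oddfib fK 0 x -> x = 0 \/ x = y) ->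
  ~ oddfib fK 0 0 -> (forall x, oddfib fK y x <-> x = 0) -> form_e f iota.
Proof.
move=> yE y0 H zE fy.
have P0 := subC_neq0 y fK_gt1.
have [B yB] : exists B, y = iota B.
  have /oddfib_horner <- : oddfib fK y 0 by apply/fy.
  by exists f.[0]; rewrite -[in LHS](rmorph0 iota) horner_map.
have [g gm eg] := oddroots_decomp fK_neq0; have [k km ek] := oddroots_decomp P0.
have sg := size_oddroots_decomp fK_neq0 gm eg.
have sk := size_oddroots_decomp P0 km ek.
have pg : perm_eq (oddroots fK) [:: y].
  apply: (perm_oddroots fK_neq0 (s := [:: y]) isT) => x.
  have -> : odd (mup x fK) = oddfib fK 0 x by rewrite /oddfib polyC0 subr0.
  rewrite inE; split=> [h|/eqP ->]; last exact: yE.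
  case: (H x h) => [x0|->]; last exact: eqxx.
  by rewrite x0 in h; case: (zE h).
have pk : perm_eq (oddroots (fK - y%:P)) [:: 0].
  apply: (perm_oddroots P0 (s := [:: 0]) isT) => x; rewrite inE.
  split=> [/fy ->|/eqP x0]; first exact: eqxx.
  exact: (proj2 (fy x) x0).
rewrite (perm_size pg) szfK /= in sg; rewrite (perm_size pk) (size_subC y fK_gt1) szfK /= in sk.
rewrite (perm_big _ pg) big_seq1 /= leadK in eg.
rewrite (perm_big _ pk) big_seq1 /= polyC0 subr0 (lead_coef_subC y fK_gt1) leadK in ek.
have g0 : (0 < size g)%N by rewrite size_poly_gt0 monic_neq0.
have k0 : (0 < size k)%N by rewrite size_poly_gt0 monic_neq0.
have A0 : iota (lead_coef f) != 0 by rewrite fmorph_eq0 lead_coef_eq0.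
pose n := (size g).-1.
have sgn : size g = n.+1 by rewrite /n prednK.
have skn : size k = n.+1.
  by move: sg sk k0; rewrite /n; move: (size g).-1 (size k); clear; lia.
have e2 : iota (lead_coef f) *: (('X - y%:P) * g ^+ 2) - y%:P
    = iota (lead_coef f) *: ('X * k ^+ 2) by rewrite -eg -ek.
exists (lead_coef f), B, n, (fun i => g`_i); split.
- by rewrite -sgn coefK -mulrA mul_polyC -yB -eg.
- rewrite -horner_coef0; have := congr1 (fun P : {poly K} => P.[0]) e2.
  rewrite !hornerE /= ?(mul0r, mulr0) => /eqP; rewrite subr_eq0 => /eqP e.
  apply: (mulfI A0); apply: (mulfI y0); apply: oppr_inj.
  by rewrite [_ * - _^-1]mulrN (divff A0) mulrN1 opprK -[RHS]e; ring.
- move=> i hi; rewrite -yB.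
  have rec := recurrence_e two_neq0_closure A0 y0 gm km sgn skn e2 hi.
  exact rec.
Qed.

Theorem primitive_odd_of_not_forms :
  ~ form_a f p -> ~ form_b f -> ~ form_c f -> ~ form_d f iota -> ~ form_e f iota ->
  forall n, exists x, primitive_odd fK n x.
Proof.
move=> na nb nc nd ne.
have [D [fib3 fib_le] [D1|[c [b [e he]]]]] := fiber_bounds pchar_closure p_odd fK_gt1; last first.
  by case: na; apply: form_a_of_single_root he.
case: (primitive_odd_nonempty fK_gt1 D1 fib3 fib_le) => //.
  by case/form_b_c_of_fiber.
case=> y [y0 yE H [[z0 none]|[z0 fy]]].
  by case: nd; apply: form_d_of_fiber yE y0 H z0 none.
by case: ne; apply: form_e_of_fiber yE y0 H z0 fy.
Qed.

End Descent.

(** * Counting the orbit *)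

Lemma card_bigcup_le (T I : finType) (A : I -> {set T}) :
  (#|\bigcup_i A i| <= \sum_i #|A i|)%N.
Proof.
elim/big_rec2: _ => [|i n B _ IH]; first by rewrite cards0.
by apply: leq_trans (leq_card_setU _ _) _; rewrite leq_add2l.
Qed.

Lemma nat_sqrt_exists q : exists s, (s ^ 2 <= q < s.+1 ^ 2)%N.
Proof.
elim: q => [|q [s /andP[h1 h2]]]; first by exists 0%N.
case: (ltnP q.+1 (s.+1 ^ 2)) => h; first by exists s; rewrite h ltnW.
by exists s.+1; rewrite h /=; nia.
Qed.

Lemma sum_expn_le d r : (2 <= d)%N -> (\sum_(i < r) d ^ i <= d ^ r)%N.
Proof.
move=> hd; elim: r => [|r IH]; first by rewrite big_ord0.
rewrite big_ord_recr /= expnS; apply: (@leq_trans (2 * d ^ r)%N).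
  by rewrite mul2n -addnn leq_add2r.
by rewrite leq_mul2r hd orbT.
Qed.

Lemma periodic_modn (T : Type) (u : nat -> T) m n : is_period_of u m ->
  u n = u (n %% m)%N.
Proof.
case=> _ hu; rewrite {1}(divn_eq n m) addnC; elim: (n %/ m)%N => [|k IH].
  by rewrite mul0n addn0.
by rewrite mulSn addnCA addnC hu.
Qed.

Lemma size_prod_comp_iter (F : fieldType) (f : {poly F}) d r (S : {set 'I_r}) :
  (2 <= d)%N -> size f = d.+1 ->
  (size (\prod_(i in S) comp_iter f i)%R <= (d ^ r).+1)%N.
Proof.
move=> hd szf; have d0 : (0 < d)%N by apply: ltnW.
apply: leq_trans (_ : _ <= (\sum_(i in S) d ^ i).+1)%N _.
  elim/big_rec2: _ => [|i n P _ IH]; first by rewrite size_poly1.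
  apply: leq_trans (size_polyMleq _ _) _; rewrite (size_comp_iter _ szf) //; lia.
rewrite ltnS; apply: leq_trans (sum_expn_le r hd).
by rewrite [leqRHS](bigID (mem S)) leq_addr.
Qed.

Lemma orbit_count (F : finFieldType) (p a g d s r m : nat) (f : {poly F}) (x : F) :
  prime p -> #|F| = (p ^ a)%N -> #|F| = g.*2.+1 -> (2 <= d)%N -> size f = d.+1 ->
  (forall r (S : {set 'I_r}), S != finset.set0 -> nonsquare (\prod_(i in S) comp_iter f i)) ->
  (s ^ 2 <= #|F| < s.+1 ^ 2)%N -> ((2 * d) ^ r <= s)%N ->
  is_period_of (fun n => quad_char (poly_iter f n).[x]) m ->
  (#|forward_orbit f x| * 2 ^ r <= 42 * (m * #|F|))%N.
Proof.
move=> p_pr cF qE hd szf fns sq hr per; have [m0 _] := per.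
have d0 : (0 < d)%N by apply: ltnW.
have s0 : (0 < s)%N by apply: leq_trans hr; rewrite expn_gt0 muln_gt0 d0.
pose u n := quad_char (comp_iter f n).[x].
have per' : is_period_of u m := per.
pose A (j : 'I_m) := [set b : F | [forall i : 'I_r, quad_char (comp_iter f i).[b] == u (j + i)%N]].
have orbA : (#|forward_orbit f x| <= \sum_j #|A j|)%N.
  apply: leq_trans (card_bigcup_le A); apply: subset_leq_card.
  apply/fintype.subsetP => b; rewrite inE => /asboolP[n ->].
  have hj : (n %% m < m)%N by rewrite ltn_mod.
  apply/bigcupP; exists (Ordinal hj); rewrite // inE; apply/forallP => i /=.
  rewrite -horner_comp -comp_iterD -/(u _) addnC.
  by rewrite (periodic_modn (n + i) per') (periodic_modn (_ %% _ + _) per') modnDml.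
have cA (j : 'I_m) : (#|A j| * 2 ^ r <= #|F| + 2 ^ r * (41 * d ^ r * s))%N.
  case: (boolP [forall i : 'I_r, u (j + i)%N != 0]) => [/forallP hu|].
    apply: (sign_pattern_count qE p_pr cF (G := fun i : 'I_r => comp_iter f i)
      (u := fun i : 'I_r => u (j + i)%N)) => [i|S S0].
      move: (hu i); rewrite /u.
      case: (quad_char_cases (comp_iter f (j + i)).[x]) => ->; rewrite ?eqxx //.
        by left.
      by right.
    apply: (quad_char_sum_bound qE p_pr cF (fns _ _ S0)) => //.
      by rewrite expn_gt0 d0.
    exact: size_prod_comp_iter.
  (* If a prescribed sign is [0], the expansion does not apply, but [A j] then consists of roots of
     one iterate. *)
  rewrite negb_forall => /existsP[i]; rewrite negbK => /eqP ui.
  have Ai : (#|A j| <= d ^ i)%N.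
    have fi0 : comp_iter f i != 0 by rewrite -size_poly_gt0 (size_comp_iter _ szf).
    rewrite -ltnS -(size_comp_iter i szf d0) cardE.
    apply: max_poly_roots fi0 _ (enum_uniq _); apply/allP => b.
    rewrite mem_enum inE => /forallP /(_ i); rewrite ui /quad_char rootE.
    by case: ifP => // _; case: ifP.
  have di : (d ^ i <= d ^ r)%N by rewrite leq_exp2l // ltnW.
  apply: leq_trans (_ : 2 ^ r * (41 * d ^ r * s) <= _)%N; last exact: leq_addl.
  rewrite mulnC leq_mul2l; apply/orP; right.
  apply: leq_trans Ai (leq_trans di _); nia.
(* The choice [(2 * d) ^ r <= s] makes the error term at most [41 * q]. *)
have main : (2 ^ r * (d ^ r * s) <= #|F|)%N.
  case/andP: sq => sq _; apply: leq_trans sq.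
  by rewrite mulnA -expnMn expnS expn1 leq_mul2r hr orbT.
have cA' (j : 'I_m) : (#|A j| * 2 ^ r <= 42 * #|F|)%N.
  by apply: leq_trans (cA j) _; nia.
apply: leq_trans (leq_mul orbA (leqnn _)) _; rewrite big_distrl /=.
apply: (@leq_trans (\sum_(j < m) 42 * #|F|)%N); first by apply: leq_sum => j _.
by rewrite sum_nat_const card_ord mulnCA.
Qed.

(** The exponent is [1 - ln 2 / (2 * ln (2 * d))], and the hypothesis says
    [ln q <= 2 * r * ln (2 * d)]; so the missing power of [q] is at most [2 ^+ r]. *)
Lemma powR_exponent_bound (R : realType) (d q r : nat) : (2 <= d)%N -> (0 < q)%N ->
  (q <= ((2 * d) ^ r) ^ 2)%N ->
  q%:R <= 2 ^+ r * powR q%:R ((2 * log2 d%:R + 1) / (2 * log2 d%:R + 2)) :> R.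
Proof.
move=> hd q0 hq; have q0' : (0 : R) < q%:R by rewrite ltr0n.
have d0 : (0 : R) < d%:R by rewrite ltr0n ltnW.
have l2 : (0 : R) < ln 2 by rewrite ln_gt0 // ltr1n.
have ld : (0 : R) < ln d%:R by rewrite ln_gt0 // ltr1n.
have lq : ln q%:R <= 2 * r%:R * (ln 2 + ln d%:R) :> R.
  have h : q%:R <= (2 * d)%:R ^+ (r * 2) :> R by rewrite -natrX ler_nat expnM.
  have p0 : (0 : R) < (2 * d)%:R by rewrite natrM mulr_gt0.
  rewrite -ler_ln ?posrE ?exprn_gt0 // lnXn // -[leRHS]mulr_natl !natrM lnM ?posrE // in h.
  by rewrite [2 * r%:R]mulrC.
set b := _ / _; rewrite /powR (gt_eqF q0').
rewrite -[X in X <= _](@lnK R q%:R) ?posrE // -[X in X ^+ _](@lnK R 2) ?posrE //.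
rewrite -expRM_natl -expRD ler_expR.
have hb : b = 1 - ln 2 / (2 * (ln 2 + ln d%:R)).
  rewrite /b /log2; field; apply/and3P; split; lra.
rewrite hb mulrBl mul1r addrCA lerDl subr_ge0.
have -> : ln 2 / (2 * (ln 2 + ln d%:R)) * ln q%:R = ln 2 * (ln q%:R / (2 * (ln 2 + ln d%:R))) :> R.
  by rewrite mulrAC mulrA.
rewrite [leRHS]mulrC ler_pM2l // ler_pdivrMr; last lra.
by rewrite mulrA [r%:R * 2]mulrC.
Qed.

Theorem theorem1p1 (R : realType) (d : nat) (hd : (2 <= d)%N) :
  exists C : R, 0 < C /\
    forall (p k : nat) (F : finFieldType)
      (K : closedFieldType) (iota : {rmorphism F -> K})
      (f : {poly F}) (a : F) (m : nat),
      prime p -> odd p -> (1 <= k)%N -> #|F| = (p ^ k)%N ->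
      integralRange iota ->
      size f = d.+1 ->
      ~ form_a f p -> ~ form_b f -> ~ form_c f ->
      ~ form_d f iota -> ~ form_e f iota ->
      is_least_period_of (fun n : nat => quad_char (poly_iter f n).[a]) m ->
      #|forward_orbit f a|%:R
        <= C * (m%:R *
             powR #|F|%:R
               ((2 * log2 d%:R + 1) / (2 * log2 d%:R + 2))).
Proof.
(* The constant [42] of [orbit_count], doubled because the exponent estimate holds with [r + 1]
   instead of [r]. *)
exists 84; split; first by rewrite ltr0n.
move=> p k F K iota f a m p_pr p_odd k0 cF _ szf na nb nc nd ne [per _].
have d0 : (0 < d)%N by apply: ltnW.
have qE : #|F| = (#|F|./2).*2.+1.
  by rewrite -[LHS]odd_double_half cF oddX p_odd orbT.
have prim := primitive_odd_of_not_forms p_pr p_odd cF hd szf na nb nc nd ne.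
have fns r (S : {set 'I_r}) : S != finset.set0 -> nonsquare (\prod_(i in S) comp_iter f i).
  move=> S0; apply: (@nonsquare_map _ _ iota); rewrite rmorph_prod /=.
  have -> : \prod_(i in S) map_poly iota (comp_iter f i)
      = \prod_(i in S) comp_iter (map_poly iota f) i.
    apply: eq_bigr => i _; elim: (nat_of_ord i) => [|n IH]; first by rewrite /= map_polyX.
    by rewrite /= map_comp_poly IH.
  have szK : size (map_poly iota f) = d.+1 by rewrite size_map_poly.
  exact: (nonsquare_prod_comp_iter szK d0 prim S0).
have [s sq] := nat_sqrt_exists #|F|; have s0 : (0 < s)%N by case: s sq => //; rewrite qE.
have d1 : (1 < 2 * d)%N by lia.
(* The largest [r] allowed in [orbit_count]; maximality gives [q < (s + 1) ^ 2 <= ((2 * d) ^ (r +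
   1)) ^ 2]. *)
pose r := trunc_log (2 * d) s.
have count := orbit_count p_pr cF qE hd szf fns sq (trunc_logP d1 s0) per.
have sr : (#|F| <= ((2 * d) ^ r.+1) ^ 2)%N.
  case/andP: sq => _ /ltnW sq; apply: leq_trans sq _.
  by rewrite leq_exp2r // trunc_log_ltn.
have q0 : (0 < #|F|)%N by rewrite qE.
have := powR_exponent_bound R hd q0 sr; set w := powR _ _ => hw.
have r0 : (0 : R) < 2 ^+ r by rewrite exprn_gt0.
rewrite -(ler_pM2r r0) -natrX -natrM.
apply: le_trans (_ : (42 * (m * #|F|))%:R <= _); first by rewrite ler_nat.
have m0 : 0 <= m%:R :> R by [].
rewrite !natrM natrX; move: hw; rewrite exprS => hw.
have := ler_wpM2l m0 hw; lra.
Qed.
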